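(* The class $\overrightarrow{\mathcal A}^\infty_{\infty,0,\infty,\infty}$ of convex orderings of members of $\mathcal A^\infty_{\infty,0,\infty,\infty}$, expanded by an additional unary predicate determining the bipartition, is Ramsey and has the expansion property.
   Context: $\mathcal A^\infty_{\infty,0,\infty,\infty}$ is the class of all finite metric spaces with positive integer distances containing no triangle of odd perimeter. In such a space, ''$d(u,v)$ is even'' is an equivalence relation with at most two classes; a unary predicate $P$ determines the bipartition if $d(u,v)$ is even iff $u,v$ are both in $P$ or both outside $P$. A convex ordering is a linear order in which the vertices of $P$ form an initial segment. A class $\mathcal C$ is Ramsey if for all $\mathbf A,\mathbf B\in\mathcal C$ and $k\ge1$ there is $\mathbf C\in\mathcal C$ such that for every $k$-colouring of the copies of $\mathbf A$ in $\mathbf C$ some copy of $\mathbf B$ in $\mathbf C$ has all its copies of $\mathbf A$ of one colour. A class $\mathcal K^+$ of expansions of $\mathcal K$ has the expansion property if for every $\mathbf A\in\mathcal K$ there is $\mathbf B\in\mathcal K$ such that every expansion of $\mathbf A$ in $\mathcal K^+$ embeds into every expansion of $\mathbf B$ in $\mathcal K^+$. *)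

(* Defs.v *)
From mathcomp Require Import all_boot.
Set Implicit Arguments.
Unset Strict Implicit.
Unset Printing Implicit Defensive.

Record mspace := MSpace {
  point :> finType;
  dist : point -> point -> nat;
  dist_eq0 : forall x y, dist x y = 0 <-> x = y;
  dist_sym : forall x y, dist x y = dist y x;
  dist_triangle : forall x y z, dist x z <= dist x y + dist y z
}.

Definition no_odd_triangle (M : mspace) : Prop :=
  forall x y z : M, x <> y -> y <> z -> x <> z ->
    ~~ odd (dist x y + dist y z + dist x z).

(* Raw expansion data; the axioms are imposed by convex_expansion below. *)
Record expansion (M : mspace) := Expansion {
  ord : rel M;
  upred : {set M}
}.

Record emspace := EMSpace {
  reduct :> mspace;
  exp_of : expansion reduct
}.

Definition ole (M : emspace) : rel M := ord (exp_of M).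
Definition bpart (M : emspace) : {set M} := upred (exp_of M).

Definition linear_order (T : Type) (r : rel T) : Prop :=
  [/\ reflexive r, antisymmetric r, transitive r & total r].

Definition determines_bipartition (M : emspace) : Prop :=
  forall u v : M,
    ~~ odd (dist u v) <->
    (u \in bpart M /\ v \in bpart M) \/ (u \notin bpart M /\ v \notin bpart M).

Definition convex_ordering (M : emspace) : Prop :=
  linear_order (@ole M) /\
  forall u v : M, v \in bpart M -> ole u v -> u \in bpart M.

Definition convex_expansion (M : emspace) : Prop :=
  [/\ no_odd_triangle M, determines_bipartition M & convex_ordering M].

Definition embedding (A B : emspace) (f : A -> B) : Prop :=
  [/\ injective f,
      forall x y, dist (f x) (f y) = dist x y,
      forall x y, ole (f x) (f y) = ole x y
    & forall x, (f x \in bpart B) = (x \in bpart A)].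

Definition embeds (A B : emspace) : Prop :=
  exists f : A -> B, embedding f.

(* X is the vertex set of a substructure of B isomorphic to A. A substructure *)
(* is determined by its vertex set, so copies are identified with such sets.  *)
Definition is_copy (A B : emspace) (X : {set B}) : Prop :=
  exists f : A -> B, embedding f /\ X = f @: [set: A].

(* The colouring chi is defined on all subsets of C, but only its values on   *)
(* copies of A are used; for k > 0 every colouring of the copies extends.     *)
Definition ramsey (K : emspace -> Prop) : Prop :=
  forall A B : emspace, K A -> K B -> forall k : nat, 0 < k ->
  exists C : emspace, K C /\
    forall chi : {set C} -> 'I_k,
    exists B' : {set C}, is_copy B B' /\
      exists c : 'I_k, forall A' : {set C},
        is_copy A A' -> A' \subset B' -> chi A' = c.

Definition expansion_property (K : mspace -> Prop) (Kplus : emspace -> Prop)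
    : Prop :=
  forall A : mspace, K A ->
  exists B : mspace, K B /\
    forall (a : expansion A) (b : expansion B),
      Kplus (EMSpace a) -> Kplus (EMSpace b) ->
      embeds (EMSpace a) (EMSpace b).

(* Main.v *)
Require Import Defs.
From mathcomp Require Import all_boot zify.
Set Implicit Arguments.
Unset Strict Implicit.
Unset Printing Implicit Defensive.

(** Fix a bound [D] on the distances and attach to a space [M] the finite set of
    1-Lipschitz functions [M -> {0, ..., 2D+1}] that are even exactly on the
    predicate.  Listing the values of such functions embeds [M] isometrically
    into a grid of integer vectors with coordinates of equal parity, under the
    sup metric and the lexicographic order, and a word whose letters are
    Lipschitz functions is such an embedding.

    Order the Lipschitz functions by their most significant difference: the
    highest level first and, at that level, the smallest point.  The least
    extension of a function along an embedding [A -> B] differs from another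
    extension most significantly on the image of [A], so restriction from [B]
    to [A] is a rigid surjection, that is, a parameter word.  The Ramsey
    property is then an instance of the Graham-Rothschild theorem.

    For the expansion property, apply the Ramsey property to pairs of points of
    each even distance on each side of the bipartition of a large grid.  Another
    convex order then agrees with the grid order, or reverses it, uniformly for
    each distance and side.  Triangles with sides [d, d, 2] show that the sign
    does not depend on the distance, so that the other order is a twist of the
    grid order, and the grid contains all twists of all expansions of [A]. *)

Notation letter := (nat + nat)%type.
Notation Cst c := (inl c : letter).
Notation Var i := (inr i : letter).

(** * Parameter words *)

Definition is_var (l : letter) := if l is inr _ then true else false.

Definition known t i (l : letter) :=
  match l with inl c => c < t | inr j => j < i end.

(* [w] uses constants below [t] and variables below [m]; the variables below [i] are
   already available, the others first occur in increasing order. *)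
Fixpoint pword t i (m : nat) (w : seq letter) :=
  match w with
  | [::] => i == m
  | inl c :: w' => (c < t) && pword t i m w'
  | inr j :: w' => if j == i then pword t i.+1 m w' else (j < i) && pword t i m w'
  end.

Definition param_word t (m n : nat) w := pword t 0 m w && (size w == n).

(** Variables out of range go to [Cst 0]; in a composition of parameter words of matching sizes this
    does not happen. *)
Definition subst (u : seq letter) (l : letter) : letter :=
  match l with inl c => inl c | inr i => nth (Cst 0) u i end.

Definition wcomp (w u : seq letter) := map (subst u) w.

Definition const_prefix (w : seq letter) := take (find is_var w) w.

Lemma pword_known t i m l w : known t i l -> pword t i m (l :: w) = pword t i m w.
Proof.
case: l => [c|j] /= h; first by rewrite h.
by rewrite h; case: eqP => // e; lia.
Qed.

Lemma pword_cat_known t i m w z :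
  all (known t m) z -> pword t i m w -> pword t i m (w ++ z).
Proof.
move=> hz; elim: w i => [|[c|j] w IH] i /=.
- move/eqP->; elim: z hz => [|l z IH]; first by rewrite /= eqxx.
  by case/andP=> hl /IH hz; rewrite pword_known.
- by case/andP=> -> /IH.
- by case: eqP => _ => [/IH //|/andP[-> /IH]].
Qed.

Lemma pword_catV t i m w j : pword t i m w -> j = m -> pword t i m.+1 (w ++ [:: Var j]).
Proof.
move=> hw ->; elim: w i hw => [|[c|k] w IH] i /=.
- by move/eqP->; rewrite !eqxx.
- by case/andP=> -> /IH.
- by case: eqP => _ => [/IH //|/andP[-> /IH]].
Qed.

Lemma pword_iota t i k : pword t i (i + k) [seq Var j | j <- iota i k].
Proof.
elim: k i => [|k IH] i /=; first by rewrite addn0.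
by rewrite eqxx addnS -addSn.
Qed.

Lemma pword_le t i m w : pword t i m w -> i <= m.
Proof.
elim: w i => [|[c|k] w IH] i /=; first by move/eqP->.
- by case/andP=> _ /IH.
- by case: eqP => _ => [/IH /ltnW|/andP[_ /IH]].
Qed.

Lemma pword_size t i m w : pword t i m w -> m - i <= size w.
Proof.
elim: w i => [|[c|k] w IH] i /=; first by move/eqP->; rewrite subnn.
- by case/andP=> _ /IH; lia.
- by case: eqP => _ => [/IH|/andP[_ /IH]]; lia.
Qed.

Lemma pword_mono t t' i m w : t <= t' -> pword t i m w -> pword t' i m w.
Proof.
move=> ht; elim: w i => [|[c|k] w IH] i //=.
- by case/andP=> hc /IH->; rewrite (leq_trans hc).
- by case: eqP => _ => [/IH|/andP[-> /IH]].
Qed.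

Lemma pword_all_known t i m w : pword t i m w -> all (known t m) w.
Proof.
elim: w i => [|[c|k] w IH] i //=.
- by case/andP=> -> /IH.
- case: eqP => [->|_]; first by move=> h; rewrite (IH _ h) andbT (pword_le h).
  by case/andP=> hk h; rewrite (IH _ h) andbT (leq_trans hk (pword_le h)).
Qed.

Lemma known_mono t i j l : i <= j -> known t i l -> known t j l.
Proof. by case: l => //= k hij hk; apply: leq_trans hij. Qed.

(** Generalised to the middle of a word for the induction: once [i] variables of [w] have appeared,
    the letters substituted for them use variables below [j] only, and the rest of [u] continues
    from [j]. *)
Lemma pword_wcomp t i j m k w u :
  size u = m -> i <= m -> all (known t j) (take i u) -> pword t j k (drop i u) ->
  pword t i m w -> pword t j k (wcomp w u).
Proof.
move=> su; elim: w i j => [|[c|x] w IH] i j hi ha hd /=.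
- by move/eqP=> e; move: hd; rewrite e -su drop_size.
- by case/andP=> -> hw; apply: IH ha hd hw.
- case: eqP => [-> hw|_ /andP[hx hw]].
  + have hm : i < m by apply: pword_le hw.
    move: hd; rewrite (drop_nth (Cst 0)) ?su //.
    have hall j' : j <= j' -> known t j' (nth (Cst 0) u i) ->
        all (known t j') (take i.+1 u).
      move=> hj hk; rewrite (take_nth (Cst 0)) ?su // all_rcons hk /=.
      by apply: sub_all ha => l; apply: known_mono.
    move: hall; case: (nth _ u i) => [c|y] hall /=.
      by case/andP=> hc hd; rewrite hc; apply: IH hd hw => //; apply: hall.
    case: eqP => [e hd|_ /andP[hy hd]].
      by apply: IH hd hw => //; apply: hall => //=; rewrite e.
    by rewrite hy; apply: IH hd hw => //; apply: hall.
  + rewrite -[X in is_true X]/(pword t j k (nth (Cst 0) u x :: wcomp w u)).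
    rewrite pword_known; first exact: IH hw.
    have hxs : x < size (take i u) by rewrite size_takel ?su.
    have := all_nthP (Cst 0) ha x hxs.
    by rewrite nth_take.
Qed.

Lemma param_word_wcomp t k m n w u :
  param_word t m n w -> param_word t k m u -> param_word t k n (wcomp w u).
Proof.
case/andP=> hw /eqP <- /andP[hu /eqP su].
rewrite /param_word size_map eqxx andbT.
by apply: pword_wcomp hw => //; rewrite ?drop0 ?take0.
Qed.

Lemma wcompA w u v : wcomp (wcomp w u) v = wcomp w (wcomp u v).
Proof.
rewrite /wcomp -map_comp; apply: eq_map => -[c|i] //=.
case: (ltnP i (size u)) => hi; first by rewrite (nth_map (Cst 0)).
by rewrite !nth_default // size_map.
Qed.

Lemma wcomp_cat w1 w2 u : wcomp (w1 ++ w2) u = wcomp w1 u ++ wcomp w2 u.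
Proof. exact: map_cat. Qed.

(* The Graham-Rothschild statement for [t] constants and words with [k] variables;
   [k = 0] is the multidimensional Hales-Jewett theorem. *)
Definition gr t k := forall (m : nat) (K : finType), exists n, forall chi : seq letter -> K,
  exists w c, param_word t m n w /\
    forall u, param_word t k m u -> chi (wcomp w u) = c.

(** A longer word is obtained by padding with constants, which substitution leaves alone. *)
Lemma gr_mono t k m (K : finType) : 0 < t -> gr t k ->
  exists n0, forall n, n0 <= n -> forall chi : seq letter -> K,
  exists w c, param_word t m n w /\
    forall u, param_word t k m u -> chi (wcomp w u) = c.
Proof.
move=> t0 /(_ m K) [n0 H]; exists n0 => n hn chi.
pose z := nseq (n - n0) (Cst 0).
have [w [c [/andP[hw /eqP sw] hc]]] := H (fun w => chi (w ++ z)).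
exists (w ++ z), c; split.
  apply/andP; split; last by rewrite size_cat size_nseq sw subnKC.
  by apply: pword_cat_known; rewrite ?all_nseq /= ?t0 ?orbT.
by move=> u /hc; rewrite wcomp_cat [wcomp z u]map_nseq.
Qed.

(** * The Hales-Jewett theorem *)

Lemma param_word0_consts t n a : param_word t 0 n a ->
  exists b : n.-tuple 'I_t, a = [seq Cst (val c) | c <- b].
Proof.
case/andP=> ha /eqP sa.
suff [b eb] : exists b : seq 'I_t, a = [seq Cst (val c) | c <- b].
  have sb : size b == n by rewrite -sa eb size_map.
  by exists (Tuple sb).
elim: a {sa} ha => [|[c|j] a IH] /=; first by exists [::].
  by case/andP=> hc /IH [b ->]; exists (Ordinal hc :: b).
by case: eqP => _ // /pword_le.
Qed.

(** Merges the largest constant [t] into [t.-1], the two letters that insensitive words do not tell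
    apart. *)
Definition lower t (l : letter) : letter :=
  if l is inl c then inl (if c == t then t.-1 else c) else l.

Definition shift_var (l : letter) : letter := if l is inr i then inr i.+1 else l.

Lemma pword_shift t i m w : pword t i.+1 m.+1 (map shift_var w) = pword t i m w.
Proof.
elim: w i => [|[c|j] w IH] i //=; first by rewrite IH.
by rewrite eqSS ltnS !IH.
Qed.

Lemma wcomp_shift w l u : wcomp (map shift_var w) (l :: u) = wcomp w u.
Proof. by rewrite /wcomp -map_comp; apply: eq_map => -[]. Qed.

Lemma size_wcomp w u : size (wcomp w u) = size w.
Proof. exact: size_map. Qed.

(* Shelah's insensitivity step. *)
Lemma insensitive_words t n (K : finType) : 0 < t ->
  exists N, forall chi : seq letter -> K, exists w, param_word t.+1 n N w /\
    forall a, param_word t.+1 0 n a -> chi (wcomp w a) = chi (wcomp w (map (lower t) a)).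
Proof.
move=> t0; elim: n K => [|n IH] K.
  exists 0 => chi; exists [::]; split=> //.
(* [N0] counts the colourings of the constant words of length [n], so two of the [N0.+1] prefixes
   [W j] below induce the same colouring. *)
pose N0 := #|{ffun (n.-tuple 'I_t.+1) -> K}|.
have [N HN] := IH {ffun (N0.-tuple 'I_t.+1) -> K}.
exists (N0 + N) => chi.
pose wd k (x : k.-tuple 'I_t.+1) := [seq Cst (val c) | c <- x].
(* The tail is made insensitive for all constant prefixes of length [N0] at once: its colour is a
   function of the prefix. *)
have [w' [hw' insw']] := HN (fun z => [ffun x => chi (wd N0 x ++ z)]).
pose W j := nseq j (Cst t) ++ nseq (N0 - j) (Cst t.-1).
pose F (j : 'I_N0.+1) := [ffun a : n.-tuple 'I_t.+1 => chi (W j ++ wcomp w' (wd n a))].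
have [j [j' [hjj' eF]]] : exists j j' : 'I_N0.+1, j < j' /\ F j = F j'.
  have /injectivePn [j [j' hj eF]] : ~~ injectiveb F.
    apply/negP => /injectiveP /leq_card; rewrite card_ord -/N0; lia.
  case: (ltngtP j j') => h; [by exists j, j'|by exists j', j|].
  by case/eqP: hj; apply: val_inj.
have hj'N : j' <= N0 by rewrite -ltnS.
(* Setting the variable of [L] to [t] gives [W j'], and setting it to [t.-1] gives [W j]. *)
pose L := nseq j (Cst t) ++ nseq (j' - j) (Var 0) ++ nseq (N0 - j') (Cst t.-1).
have LP b : wcomp L [:: b] = nseq j (Cst t) ++ nseq (j' - j) b ++ nseq (N0 - j') (Cst t.-1).
  by rewrite /wcomp !map_cat !map_nseq.
have Lt b u : wcomp L (b :: u) = wcomp L [:: b].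
  by rewrite /wcomp !map_cat !map_nseq.
have L1 : wcomp L [:: Cst t] = W j'.
  by rewrite LP catA -nseqD subnKC // ltnW.
have L0 : wcomp L [:: Cst t.-1] = W j.
  by rewrite LP -nseqD /W; congr (_ ++ nseq _ _); lia.
exists (L ++ map shift_var w'); split.
  have /andP [hw'1 /eqP hw'2] := hw'.
  rewrite /param_word size_cat size_map hw'2 /L !size_cat !size_nseq.
  apply/andP; split; last by apply/eqP; lia.
  have -> : j' - j = (j' - j).-1.+1 by lia.
  rewrite -!catA /=; move: (j' - j).-1 => d.
  elim: (val j) => [|i IHi] /=; last by rewrite ltnSn.
  elim: d => [|i IHi] //=.
  elim: (N0 - j') => [|i IHi] /=; last by rewrite IHi; lia.
  by rewrite pword_shift.
move=> [|b a]; first by case/andP.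
rewrite /param_word; case: b => [b|x] /=; last by case: eqP => _ // /andP[/pword_le].
rewrite eqSS -andbA => /andP[hb ha].
rewrite !(wcomp_cat L) !wcomp_shift !Lt.
have hlow : param_word t.+1 0 n (map (lower t) a).
  case/andP: ha => ha /eqP <-; rewrite /param_word size_map eqxx andbT.
  elim: a ha {hb} => [|[c|x] a IHa] //=; last by case: eqP => _ // /pword_le.
  by case/andP=> hc /IHa ->; rewrite andbT; case: eqP => //; lia.
have hLb : param_word t.+1 0 N0 (wcomp L [:: Cst b]).
  rewrite /param_word size_wcomp /L !size_cat !size_nseq.
  apply/andP; split; last by apply/eqP; lia.
  rewrite LP; apply: pword_cat_known.
    by rewrite all_cat !all_nseq /= hb !orbT /=; apply/orP; right; lia.
  by elim: (val j) => //= i ->; rewrite ltnSn.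
(* The tail is lowered first, behind a fixed leading block; the pigeonhole then lowers the leading
   block. *)
have key2 : chi (wcomp L [:: Cst b] ++ wcomp w' a) =
    chi (wcomp L [:: Cst b] ++ wcomp w' (map (lower t) a)).
  have [x ->] := param_word0_consts hLb.
  by have := insw' _ ha; move/ffunP/(_ x); rewrite !ffunE.
rewrite key2; case: eqP => [->|//].
rewrite L1 L0; have [x ->] := param_word0_consts hlow.
by have /ffunP/(_ x) := eF; rewrite !ffunE => ->.
Qed.

(** Induction on the number of constants: inside an insensitive word the largest constant can be
    lowered away, so one constant fewer has to be treated. Over a single constant there is only one
    constant word of each length. *)
Lemma hales_jewett t : 0 < t -> gr t 0.
Proof.
case: t => // t _; elim: t => [|t IH] m K.
  exists m => chi; exists [seq Var i | i <- iota 0 m], (chi (nseq m (Cst 0))); split.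
    rewrite /param_word size_map size_iota eqxx andbT.
    exact: (pword_iota 1 0 m).
  move=> u /param_word0_consts [b ->].
  congr (chi _); apply: (@eq_from_nth _ (Cst 0)).
    by rewrite size_wcomp size_map size_iota size_nseq.
  rewrite size_wcomp size_map size_iota => i hi.
  rewrite nth_nseq hi (nth_map (Cst 0)) ?size_map ?size_iota //.
  rewrite (nth_map 0) ?size_iota // nth_iota //= (nth_map ord0) ?size_tuple //.
  by rewrite ord1.
have [n Hn] := IH m K.
have [N HN] := @insensitive_words t.+1 n K isT.
exists N => chi; have [w [hw ins]] := HN chi.
have [w' [c [hw' hc]]] := Hn (fun z => chi (wcomp w z)).
have hw'2 : param_word t.+2 m n w'.
  by case/andP: hw' => h s; rewrite /param_word s (pword_mono (leqnSn _) h).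
exists (wcomp w w'), c; split; first exact: param_word_wcomp hw'2.
move=> u hu; rewrite wcompA ins; last exact: param_word_wcomp hu.
(* Lowering passes through [w'], in which the largest constant does not occur. *)
have -> : map (lower t.+1) (wcomp w' u) = wcomp w' (map (lower t.+1) u).
  have /andP[/pword_all_known hk _] := hw'.
  rewrite /wcomp -map_comp; apply/eq_in_map => -[x|i] /(allP hk) /= hx.
    by case: eqP => // e; lia.
  case: (ltnP i (size u)) => hi; first by rewrite (nth_map (Cst 0)).
  by rewrite !nth_default // size_map.
apply: hc; case/andP: hu => hu /eqP su; rewrite /param_word size_map su eqxx andbT.
elim: u hu {su} => [|[x|i] u IHu] //=; last by case: eqP => _ // /pword_le.
by case/andP=> hx /IHu ->; rewrite andbT; case: eqP => //; lia.
Qed.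

(** * The Graham-Rothschild theorem *)

(** After a first letter [Var 0], the tail of a word with [k.+1] variables over [t] constants
    amounts to a word with [k] variables over [t.+1] constants: the extra constant [t] stands for
    variable 0. *)
Definition const_to_var t (l : letter) : letter :=
  match l with inl c => if c == t then inr 0 else inl c | inr i => inr i.+1 end.

Definition var_to_const t (l : letter) : letter :=
  match l with inl c => inl c | inr 0 => inl t | inr i.+1 => inr i end.

Definition set_const t d (l : letter) : letter :=
  if l is inl c then inl (if c == t then d else c) else l.

Lemma pword_const_to_var t i m w :
  pword t.+1 i m w -> pword t i.+1 m.+1 (map (const_to_var t) w).
Proof.
elim: w i => [|[c|j] w IH] i //=.
  case/andP=> hc /IH; case: eqP => [_|h] //= ->.
  by rewrite andbT; lia.
by rewrite eqSS ltnS; case: eqP => _ => [/IH|/andP[-> /IH]].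
Qed.

Lemma pword_var_to_const t i m w :
  pword t i.+1 m.+1 w -> pword t.+1 i m (map (var_to_const t) w).
Proof.
elim: w i => [|[c|[|j]] w IH] i //=.
- by case/andP=> hc /IH->; rewrite (leq_trans hc).
- by move/IH->; rewrite ltnSn.
- by rewrite eqSS ltnS; case: eqP => _ => [/IH|/andP[-> /IH]].
Qed.

Lemma var_to_constK t m w : all (known t m) w ->
  map (const_to_var t) (map (var_to_const t) w) = w.
Proof.
move=> hw; rewrite -map_comp; apply: map_id_in => -[c|[|i]] /(allP hw) //= h.
  by case: eqP => //; lia.
by rewrite eqxx.
Qed.

(** Induction on [M], by the first letter of [u]. If it is a variable, the tail is a word with [k]
    variables over [t.+1] constants, and [gr t.+1 k] yields a single colour. If it is a constant,
    the induction hypothesis treats all constants at once, with functions of the constant as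
    colours. *)
Lemma prefix_dependent t k : 0 < t -> gr t.+1 k -> forall M (K : finType),
  exists N, forall chi : seq letter -> K, exists w, param_word t M N w /\
    forall u u', param_word t k.+1 M u -> param_word t k.+1 M u' ->
      const_prefix u = const_prefix u' -> chi (wcomp w u) = chi (wcomp w u').
Proof.
move=> t0 GR; elim=> [|M IH] K.
  by exists 0 => chi; exists [::]; split=> // -[|l u] u' /andP[].
have [M' HM'] := IH {ffun 'I_t -> K}; have [N HN] := GR M' K.
exists N.+1 => chi.
have [w1 [col [hw1 hcol]]] := HN (fun z => chi (Var 0 :: map (const_to_var t) z)).
have [w2 [hw2 hpre]] := HM' (fun y =>
  [ffun c : 'I_t => chi (Cst (val c) :: wcomp (map (set_const t c) w1) y)]).
have hw2' : param_word t.+1 M M' w2.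
  by case/andP: hw2 => h s; rewrite /param_word s (pword_mono (leqnSn _) h).
(* The constant [t] of [w1] marks the further places of variable 0; [set_const] fills them when the
   first letter of [u] is a constant. *)
pose w := Var 0 :: map (const_to_var t) (wcomp w1 w2).
have hw : param_word t M.+1 N.+1 w.
  have /andP[h /eqP s] := param_word_wcomp hw1 hw2'.
  by rewrite /param_word /= size_map s eqxx andbT; apply: pword_const_to_var.
exists w; split=> //.
have caseV v : param_word t k.+1 M.+1 (Var 0 :: v) -> chi (wcomp w (Var 0 :: v)) = col.
  case/andP=> /= hv; rewrite eqSS => /eqP sv.
  pose v' := map (var_to_const t) v.
  have hv' : param_word t.+1 k M v'.
    by rewrite /param_word size_map sv eqxx andbT; apply: pword_var_to_const.
  rewrite -(hcol (wcomp w2 v')); last exact: param_word_wcomp hv'.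
  congr (chi (_ :: _)); rewrite -wcompA /wcomp -!map_comp.
  apply: eq_map => l /=.
  have -> : v = map (const_to_var t) v'.
    by rewrite (var_to_constK (pword_all_known hv)).
  case: (subst w2 l) => [c|i] /=; first by case: eqP.
  case: (ltnP i (size v')) => hi; first by rewrite (nth_map (Cst 0)).
  have hi' : size (map (const_to_var t) v') <= i by rewrite size_map.
  rewrite (nth_default _ hi) (nth_default _ hi') /=.
  by case: eqP => //; lia.
have caseC c v : c < t -> wcomp w (Cst c :: v) =
    Cst c :: wcomp (map (set_const t c) w1) (wcomp w2 v).
  move=> hc.
  rewrite -[LHS]/(Cst c :: wcomp (map (const_to_var t) (wcomp w1 w2)) (Cst c :: v)).
  congr (_ :: _); rewrite -wcompA /wcomp -!map_comp.
  apply: eq_map => -[d|i] /=; first by case: eqP.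
  case: (ltnP i (size w2)) => hi; last first.
    by rewrite nth_default //=; case: eqP => //; lia.
  have /andP[/pword_all_known hk _] := hw2.
  have := allP hk _ (mem_nth (Cst 0) hi).
  by case: (nth _ w2 i) => //= d hd; case: eqP => //; lia.
move=> [|[c|j] u]; first by move=> u' /andP[].
- move=> [|[c'|j'] u']; first by move=> _ /andP[].
  + move=> hu hu' e.
    have [ec eu] : c = c' /\ const_prefix u = const_prefix u' by case: e.
    have /andP[hc hu1] : (c < t) && param_word t k.+1 M u.
      by move: hu; rewrite /param_word /= eqSS -andbA.
    have hu1' : param_word t k.+1 M u'.
      by move: hu'; rewrite /param_word /= eqSS -andbA => /andP[].
    rewrite -ec !caseC //.
    have := hpre _ _ hu1 hu1' eu.
    by move/ffunP/(_ (Ordinal hc)); rewrite !ffunE.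
  + by [].
- move=> [|[c'|j'] u']; first by move=> _ /andP[].
    by [].
  have z0 x v : param_word t k.+1 M.+1 (Var x :: v) -> x = 0.
    by rewrite /param_word /=; case: eqP.
  move=> hu hu' _; move: (hu) (hu'); rewrite (z0 _ _ hu) (z0 _ _ hu').
  by move=> /caseV-> /caseV->.
Qed.

(** Let the first variable of [z] be at position [p]. As the variables of [w] first occur in order,
    the prefix of the composition ends where [w] first uses variable [p], and up to there only the
    first [p] letters of [z] are substituted. *)
Lemma const_prefix_wcomp t i m w z z' : pword t i m w -> i <= size (const_prefix z) ->
  has is_var z -> has is_var z' -> const_prefix z = const_prefix z' ->
  const_prefix (wcomp w z) = const_prefix (wcomp w z').
Proof.
move=> hw hi hz hz' e.
have fe : find is_var z = find is_var z'.
  have := congr1 size e; rewrite !size_takel //; exact: find_size.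
have sz : size (const_prefix z) = find is_var z by rewrite size_takel ?find_size.
have nthe x : x < find is_var z -> nth (Cst 0) z x = nth (Cst 0) z' x.
  move=> hx; have := congr1 (fun s => nth (Cst 0) s x) e.
  by rewrite /const_prefix !nth_take // -fe.
elim: w i hw hi => [|[c|j] w IH] i //=.
  by case/andP=> _ hw hi; rewrite /const_prefix /=; congr cons; apply: IH hw hi.
have step x v v' : x < find is_var z -> const_prefix v = const_prefix v' ->
    const_prefix (nth (Cst 0) z x :: v) = const_prefix (nth (Cst 0) z' x :: v').
  move=> hx ev; rewrite -(nthe _ hx) /const_prefix /= (before_find _ hx) /=.
  by congr cons.
rewrite sz; case: eqP => [-> hw hi|_ /andP[hj hw] hi]; last first.
  by apply: step; [lia|apply: IH hw _; rewrite sz].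
case: (ltnP i (find is_var z)) => hi2.
  by apply: step => //; apply: IH hw _; rewrite sz.
have ei : i = find is_var z by lia.
by rewrite /const_prefix /= {1}ei (nth_find _ hz) ei fe (nth_find _ hz').
Qed.

Lemma has_var_wcomp t i m w z : pword t i m w -> i <= find is_var z ->
  has is_var z -> size z = m -> has is_var (wcomp w z).
Proof.
move=> hw hi hz hs; have := hz; rewrite has_find => hf.
elim: w i hw hi => [|[c|j] w IH] i /=.
- by move/eqP=> e h; lia.
- by case/andP=> _; apply: IH.
- case: eqP => [-> hw hi|_ /andP[hj hw] hi]; last by rewrite (IH _ hw) ?orbT.
  case: (ltnP i (find is_var z)) => hi2; first by rewrite (IH _ hw) ?orbT.
  have -> : i = find is_var z by lia.
  by rewrite nth_find.
Qed.

Lemma const_prefix_cat w z : has is_var w -> const_prefix (w ++ z) = const_prefix w.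
Proof.
by move=> h; rewrite /const_prefix find_cat h take_cat -has_find h.
Qed.

Lemma const_prefix_no_var w : ~~ has is_var (const_prefix w).
Proof.
by elim: w => [|[c|j] w IH] //=.
Qed.

Lemma const_prefix_cat_var w i z :
  const_prefix (const_prefix w ++ Var i :: z) = const_prefix w.
Proof.
rewrite {1}/const_prefix find_cat (negbTE (const_prefix_no_var w)) /= addn0.
by rewrite take_size_cat.
Qed.

Definition consts_lt t (w : seq letter) :=
  all (fun l : letter => if l is inl c then c < t else true) w.

Lemma const_word_param t w : consts_lt t w -> ~~ has is_var w ->
  param_word t 0 (size w) w.
Proof.
rewrite /param_word eqxx andbT.
elim: w => [|[c|j] w IH] //= /andP[-> hw] h; exact: IH.
Qed.

Lemma param_word_nseq t n : 0 < t -> param_word t 0 n (nseq n (Cst 0)).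
Proof.
by move=> t0; rewrite /param_word size_nseq eqxx andbT; elim: n => //= n ->; rewrite t0.
Qed.

(* The number of variables is prescribed for each colour separately, so that the
   induction can lower just one of the prescriptions. *)
Lemma prefix_colouring t (K : finType) (f : K -> nat) : 0 < t ->
  exists N, forall n, N <= n -> forall chi : seq letter -> K,
  exists w c, param_word t (f c) n w /\
    forall u, consts_lt t u -> has is_var u -> size u = f c ->
      chi (const_prefix (wcomp w u)) = c.
Proof.
move=> t0; move: {2}(\sum_c f c) (leqnn (\sum_c f c)) => s.
elim: s f => [|s IH] f hs.
  (* Here [chi [::]] only serves to exhibit a colour. When [f c = 0], no [u] of length [f c]
     contains a variable. *)
  exists 0 => n _ chi; pose c := chi [::].
  have f0 : f c = 0.
    apply/eqP; rewrite -leqn0 (leq_trans _ hs) // (bigD1 c) //=; exact: leq_addr.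
  exists (nseq n (Cst 0)), c; split.
    by rewrite f0; apply: param_word_nseq.
  by move=> u _ + su; rewrite f0 in su; rewrite (size0nil su).
case: (boolP [exists c, f c == 0]) => [/existsP [c /eqP f0]|/existsPn fpos].
  exists 0 => n _ chi; exists (nseq n (Cst 0)), c; split.
    by rewrite f0; apply: param_word_nseq.
  by move=> u _ + su; rewrite f0 in su; rewrite (size0nil su).
(* [c0] will be the common colour of the constant words provided by Hales-Jewett; only its
   prescription is lowered. *)
pose g c0 c := if c == c0 then (f c).-1 else f c.
have hg c0 : \sum_c g c0 c <= s.
  have := fpos c0; rewrite -ltnS => h; apply: leq_trans hs.
  rewrite (bigD1 c0) //= [X in _ < X](bigD1 c0) //= /g eqxx.
  rewrite (eq_bigr f) => [|c /negbTE -> //]; lia.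
have /fin_all_exists [N HN] := fun c0 => IH _ (hg c0).
pose M := \max_c N c.
have [L HL] := gr_mono M K t0 (hales_jewett t0).
(* One last letter is reserved: it becomes a new variable if the induction returns the colour [c0],
   and a constant otherwise. *)
exists L.+1 => -[//|n] hn chi.
have [w0 [c0 [hw0 hc0]]] := HL n hn chi.
pose chi' b := chi (const_prefix (wcomp w0 (b ++ [:: Var 0]))).
have [w1 [c [hw1 hc]]] := HN c0 M (leq_bigmax c0) chi'.
have hw01 := param_word_wcomp hw0 hw1.
have [hw0p hw0s] := andP hw0; have [hw1p hw1s] := andP hw1.
have key z : size z = M -> has is_var z ->
    chi (const_prefix (wcomp w0 z)) = chi' (const_prefix z).
  move=> sz hz; congr chi; apply: const_prefix_wcomp hw0p _ hz _ _ => //.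
    by rewrite has_cat orbT.
  by rewrite const_prefix_cat_var.
have main u : consts_lt t u -> has is_var u -> size u = g c0 c ->
    has is_var (wcomp w0 (wcomp w1 u)) /\ chi (const_prefix (wcomp w0 (wcomp w1 u))) = c.
  move=> hu vu su.
  have v1 : has is_var (wcomp w1 u) by apply: has_var_wcomp hw1p _ vu su.
  have s1 : size (wcomp w1 u) = M by rewrite size_wcomp (eqP hw1s).
  by split; [apply: has_var_wcomp hw0p _ v1 s1|rewrite key // hc].
case: (eqVneq c c0) => ec; last first.
  have gc : g c0 c = f c by rewrite /g (negbTE ec).
  exists (wcomp w0 w1 ++ [:: Cst 0]), c; split.
    case/andP: hw01; rewrite /param_word gc size_cat addn1 eqSS => h ->.
    by rewrite andbT; apply: pword_cat_known; rewrite //= t0.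
  move=> u hu vu su; rewrite wcomp_cat wcompA.
  have [v e] := main u hu vu (etrans su (esym gc)).
  by rewrite const_prefix_cat.
have gc : f c = (g c0 c).+1.
  by rewrite /g ec eqxx prednK // lt0n; apply: fpos.
exists (wcomp w0 w1 ++ [:: Var (g c0 c)]), c; split.
  case/andP: hw01; rewrite /param_word gc size_cat addn1 eqSS => h ->.
  by rewrite andbT; apply: pword_catV.
case/lastP=> [//|u l]; rewrite gc size_rcons -cats1 => hu vu [su].
rewrite wcomp_cat.
have -> : wcomp [:: Var (g c0 c)] (u ++ [:: l]) = [:: l].
  by rewrite /= nth_cat su ltnn subnn.
have -> : wcomp (wcomp w0 w1) (u ++ [:: l]) = wcomp w0 (wcomp w1 u).
  rewrite wcompA; congr wcomp; apply/eq_in_map => -[d|i] //= hi.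
  have := allP (pword_all_known hw1p) _ hi => /= {}hi.
  by rewrite nth_cat su hi.
have [hu1 hl] : consts_lt t u /\ consts_lt t [:: l] by move: hu; rewrite /consts_lt all_cat => /andP.
(* If [u] has a variable, the last letter is beyond the prefix. Otherwise the last letter is the
   first variable, and the prefix is a constant word of [w0], of colour [c0]. *)
case: (boolP (has is_var u)) => vu'.
  by have [v e] := main u hu1 vu' su; rewrite const_prefix_cat.
have vl : is_var l by move: vu; rewrite has_cat (negbTE vu') /= orbF.
have pu : param_word t 0 (g c0 c) u by rewrite -su; apply: const_word_param.
have p1 := param_word_wcomp hw1 pu; have p0 := param_word_wcomp hw0 p1.
rewrite /const_prefix find_cat /= vl.
have -> : has is_var (wcomp w0 (wcomp w1 u)) = false.
  by have [b ->] := param_word0_consts p0; apply/hasP => -[x /mapP [? _ ->]].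
by rewrite addn0 take_size_cat // hc0.
Qed.

Lemma pword_drop_const t i m w : pword t i m w -> pword t i m (drop (find is_var w) w).
Proof. by elim: w => [|[c|j] w IH] //= /andP[_ /IH]. Qed.

(** First the colour is made to depend on the constant prefix only, then the induced colouring of
    prefixes is made constant. *)
Lemma gr_step t k : 0 < t -> gr t.+1 k -> gr t k.+1.
Proof.
move=> t0 GR m K.
have [M HM] := @prefix_colouring t K (fun=> m) t0.
have [N HN] := prefix_dependent t0 GR M K.
exists N => chi; have [w1 [hw1 hpre]] := HN chi.
(* [ext b] is a sample word with constant prefix [b], through which prefixes receive a colour. *)
pose ext b := b ++ [seq Var i | i <- iota 0 k.+1] ++ nseq (M - size b - k.+1) (Cst 0).
have [w2 [c [hw2 hc]]] := HM M (leqnn _) (fun b => chi (wcomp w1 (ext b))).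
exists (wcomp w1 w2), c; split; first exact: param_word_wcomp hw2.
move=> u hu; rewrite wcompA.
have pz := param_word_wcomp hw2 hu; set z := wcomp w2 u in pz *.
have [hup /eqP su] := andP hu.
have vu : has is_var u.
  by move: hup; rewrite has_find; case: ltngtP => //;
     [rewrite ltnNge find_size|move=> e /pword_drop_const; rewrite e drop_size].
have cu : consts_lt t u.
  by apply: sub_all (pword_all_known hup) => -[].
rewrite -(hc u cu vu su); apply: hpre => //.
- have [hz /eqP sz] := andP pz.
  have hd := pword_drop_const hz.
  (* All [k.+1] variables of [z] occur after its prefix, so the sample word fits into length [M]. *)
  have sd := pword_size hd; rewrite size_drop sz subn0 in sd.
  have sp : size (const_prefix z) = find is_var z by rewrite size_takel ?find_size.
  rewrite /param_word !size_cat size_map size_iota size_nseq sp.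
  apply/andP; split; last by apply/eqP; lia.
  have hp : pword t 0 0 (const_prefix z).
    have : consts_lt t (const_prefix z).
      have : consts_lt t z by apply: sub_all (pword_all_known hz) => -[].
      by rewrite /consts_lt -{1}(cat_take_drop (find is_var z) z) all_cat => /andP[].
    by move=> h; have /andP[] := const_word_param h (const_prefix_no_var z).
  rewrite /ext; move: (M - _ - _) => d.
  elim: (const_prefix z) hp => [|[x|j] y IHy] /=; last by case: eqP => _ // /pword_le.
    move=> _; apply: (@pword_cat_known _ 1 _ [seq Var i | i <- iota 1 k]).
      by rewrite all_nseq /= t0 orbT.
    exact: (pword_iota t 1 k).
  by case/andP=> -> /IHy.
- by rewrite /ext /= const_prefix_cat_var.
Qed.

Theorem graham_rothschild t k : 0 < t -> gr t k.
Proof.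
elim: k t => [|k IH] t t0; first exact: hales_jewett.
by apply: gr_step => //; apply: IH.
Qed.

(** * Lipschitz functions *)

Definition parity (M : emspace) (x : M) : nat := x \notin bpart M.

Section Lipschitz.
Variables (D : nat) (M : emspace).
Hypothesis convM : convex_expansion M.

Notation fn := {ffun M -> 'I_D.*2.+2}.
Implicit Types (h g : fn) (x y : M).

Definition lipschitz h :=
  [forall x, odd (h x) == (x \notin bpart M)] &&
  [forall x, forall y, h x <= h y + dist x y].

Lemma lipschitzP h : reflect
  ((forall x, odd (h x) = (x \notin bpart M)) /\ forall x y, h x <= h y + dist x y)
  (lipschitz h).
Proof.
apply: (iffP andP) => -[].
  by move=> /forallP h1 /forallP h2; split=> [x|x y]; [apply/eqP|apply: (forallP (h2 x))].
move=> h1 h2; split; first by apply/forallP => x; apply/eqP.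
by apply/forallP => x; apply/forallP.
Qed.

Definition parity_fun : fn := [ffun x => inord (parity x)].

Lemma parity_lt2 x : parity x < 2.
Proof. by rewrite /parity; case: (_ \notin _). Qed.

Lemma parity_funE x : parity_fun x = parity x :> nat.
Proof. by rewrite ffunE inordK // (leq_trans (parity_lt2 x)). Qed.

Lemma odd_parity x : odd (parity x) = (x \notin bpart M).
Proof. by rewrite /parity; case: (_ \notin _). Qed.

Lemma odd_dist x y : odd (dist x y) = odd (parity x + parity y).
Proof.
have [_ det _] := convM; have := det x y.
rewrite oddD !odd_parity; case: (odd (dist x y)); case: (x \in _); case: (y \in _) => //= [[h1 h2]].
all: try by have := h2 (or_introl (conj isT isT)).
all: try by have := h2 (or_intror (conj isT isT)).
all: by case: (h1 isT) => -[].
Qed.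

Lemma lipschitz_odd h x : lipschitz h -> odd (h x) = odd (parity x).
Proof. by case/lipschitzP=> -> _; rewrite odd_parity. Qed.

Lemma lipschitz_dist h x y : lipschitz h -> h x <= h y + dist x y.
Proof. by case/lipschitzP. Qed.

Lemma parity_le h x : lipschitz h -> parity x <= h x.
Proof. by move/(lipschitz_odd x); have := parity_lt2 x; lia. Qed.

Lemma distxx x : dist x x = 0.
Proof. exact/dist_eq0. Qed.

Lemma dist_gt0 x y : x != y -> 0 < dist x y.
Proof. by rewrite lt0n; apply: contraNneq => /dist_eq0 ->. Qed.

(* [kle i x j y]: level [i] at [x] is at most as significant as level [j] at [y]. *)
Definition kle (i : nat) x (j : nat) y := (i < j) || (i == j) && ole y x.

Lemma ole_refl x : ole x x.
Proof. by have [_ _ [[r _ _ _] _]] := convM; apply: r. Qed.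

Lemma ole_anti x y : ole x y -> ole y x -> x = y.
Proof. by have [_ _ [[_ a _ _] _]] := convM => h1 h2; apply: a; rewrite h1. Qed.

Lemma ole_trans x y z : ole x y -> ole y z -> ole x z.
Proof. by have [_ _ [[_ _ t _] _]] := convM; apply: t. Qed.

Lemma ole_total x y : ole x y || ole y x.
Proof. by have [_ _ [[_ _ _ t] _]] := convM; apply: t. Qed.

Lemma kle_refl i x : kle i x i x.
Proof. by rewrite /kle eqxx ole_refl orbT. Qed.

Lemma kle_trans i x j y k z : kle i x j y -> kle j y k z -> kle i x k z.
Proof.
rewrite /kle => /orP[h1|/andP[/eqP-> h1]] /orP[h2|/andP[/eqP<- h2]].
- by rewrite (ltn_trans h1).
- by rewrite h1.
- by rewrite h2.
- by rewrite eqxx (ole_trans h2 h1) orbT.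
Qed.

Lemma kle_total i x j y : kle i x j y || kle j y i x.
Proof. by rewrite /kle; case: ltngtP => //= _; apply: ole_total. Qed.

Lemma kle_anti i x j y : kle i x j y -> kle j y i x -> i = j /\ x = y.
Proof.
rewrite /kle; case: ltngtP => //= e h1 h2; split=> //; exact: ole_anti.
Qed.

Lemma kle_lt i x j y : kle i x j y -> i <= j.
Proof. by case/orP=> [/ltnW|/andP[/eqP->]]. Qed.

(** [x] carries the most significant difference and [h] is the smaller function there; the level of
    a difference is the larger of the two values. *)
Definition top_at h g x := (h x < g x) &&
  [forall y, (h y != g y) ==> kle (maxn (h y) (g y)) y (g x) x].

Definition prec h g := [exists x, top_at h g x].

Lemma top_atP h g x : reflect
  (h x < g x /\ forall y, h y != g y -> kle (h y) y (g x) x /\ kle (g y) y (g x) x)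
  (top_at h g x).
Proof.
apply: (iffP andP) => -[h1 h2]; split=> //.
  move=> y hy; have := implyP (forallP h2 y) hy.
  have k i : i <= maxn (h y) (g y) -> kle i y (maxn (h y) (g y)) y.
    by rewrite /kle leq_eqVlt orbC => /orP[->//|->]; rewrite ole_refl orbT.
  by move=> hk; split; apply: kle_trans hk; apply: k; rewrite ?leq_maxl ?leq_maxr.
apply/forallP => y; apply/implyP => /h2 [k1 k2].
by case/orP: (leq_total (h y) (g y)) => hh; rewrite ?(maxn_idPr hh) ?(maxn_idPl hh).
Qed.

Lemma prec_irr h : ~~ prec h h.
Proof. by apply/existsPn => x; rewrite /top_at ltnn. Qed.

(** The more significant of the two top differences is the top difference of the outer functions. *)
Lemma prec_trans : transitive prec.
Proof.
move=> h2 h1 h3 /existsP[x /top_atP[lx kx]] /existsP[y /top_atP[ly ky]].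
case: (boolP (kle (h2 x) x (h3 y) y)) => hk.
  have kx' z : h1 z != h2 z -> kle (h1 z) z (h3 y) y /\ kle (h2 z) z (h3 y) y.
    by move/kx=> [k1 k2]; split; apply: kle_trans hk.
  have e : h1 y = h2 y \/ h1 y < h3 y.
    case: (eqVneq (h1 y) (h2 y)) => [->|ne]; first by left.
    have [k1 _] := kx _ ne.
    have := kle_lt (kle_trans k1 hk); rewrite leq_eqVlt => /orP[/eqP e|->]; last by right.
    rewrite e in k1; have [_ exy] := kle_anti k1 hk; move: e ly; rewrite exy => e ly; lia.
  apply/existsP; exists y; apply/top_atP; split; first by case: e => [->|].
  move=> z ne; case: (eqVneq (h1 z) (h2 z)) => [e1|ne1].
    by have := ky z; rewrite -e1; apply.
  have [k1 k2] := kx' _ ne1; split=> //.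
  by case: (eqVneq (h2 z) (h3 z)) => [<-//|/ky []].
have {}hk : kle (h3 y) y (h2 x) x by have := kle_total (h2 x) x (h3 y) y; rewrite (negbTE hk).
have e3 : h2 x = h3 x.
  apply/eqP; apply/negPn/negP => ne; have [k1 k2] := ky _ ne.
  have [e exy] := kle_anti k1 hk; rewrite -exy in e ly; lia.
apply/existsP; exists x; apply/top_atP; rewrite -e3; split=> // z ne.
case: (eqVneq (h2 z) (h3 z)) => [e|/ky[k1 k2]].
  by rewrite -e; apply: kx; rewrite e.
have k3 := kle_trans k2 hk; split=> //.
case: (eqVneq (h1 z) (h2 z)) => [->|/kx[]//]; exact: kle_trans k1 hk.
Qed.

Lemma prec_total h g : h != g -> prec h g || prec g h.
Proof.
move=> ne.
have [x0 hx0] : exists x, h x != g x.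
  by apply/existsP; apply: contraNT ne => /existsPn e; apply/eqP/ffunP => x;
     apply/eqP/negPn/e.
pose mx x := maxn (h x) (g x).
have [x hx hmax] : exists2 x, h x != g x &
    forall y, h y != g y -> kle (mx y) y (mx x) x.
  have [s hs] : exists s : seq M, forall y, h y != g y -> y \in s.
    by exists (enum M) => y _; rewrite mem_enum.
  suff [x hx hm] : exists2 x, h x != g x &
      forall y, y \in s -> h y != g y -> kle (mx y) y (mx x) x.
    by exists x => // y hy; apply: hm => //; apply: hs.
  elim: s {hs} => [|z s [x hx hm]]; first by exists x0.
  case: (boolP (h z == g z)) => hz.
    by exists x => // y; rewrite inE => /orP[/eqP-> |]; [rewrite hz|apply: hm].
  case: (boolP (kle (mx z) z (mx x) x)) => hk.
    by exists x => // y; rewrite inE => /orP[/eqP-> //|]; apply: hm.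
  have {}hk : kle (mx x) x (mx z) z.
    by have := kle_total (mx x) x (mx z) z; rewrite (negbTE hk) orbF.
  exists z => // y; rewrite inE => /orP[/eqP-> _|hy hy2]; first exact: kle_refl.
  exact: kle_trans (hm _ hy hy2) hk.
case: (ltngtP (h x) (g x)) => hlt; last by rewrite (val_inj hlt) eqxx in hx.
  apply/orP; left; apply/existsP; exists x; rewrite /top_at hlt /=.
  by apply/forallP => y; apply/implyP => /hmax; rewrite /mx [maxn (h x) _](maxn_idPr (ltnW hlt)).
apply/orP; right; apply/existsP; exists x; rewrite /top_at hlt /=.
apply/forallP => y; apply/implyP; rewrite eq_sym => /hmax.
by rewrite /mx [maxn (h x) _](maxn_idPl (ltnW hlt)) maxnC.
Qed.

Definition preceq h g := (h == g) || prec h g.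

(** [parity_fun], the least Lipschitz function, is left out because the constant letter stands for
    it. *)
Definition lips : seq fn :=
  sort preceq (enum [pred h : fn | lipschitz h && (h != parity_fun)]).

Lemma mem_lips h : (h \in lips) = lipschitz h && (h != parity_fun).
Proof. by rewrite mem_sort mem_enum. Qed.

Lemma uniq_lips : uniq lips.
Proof. by rewrite sort_uniq enum_uniq. Qed.

Lemma preceq_trans : transitive preceq.
Proof.
move=> h2 h1 h3 /orP[/eqP->//|k1] /orP[/eqP<-|k2]; first by rewrite /preceq k1 orbT.
by rewrite /preceq (prec_trans k1 k2) orbT.
Qed.

Lemma lips_index h g : h \in lips -> g \in lips -> prec h g ->
  index h lips < index g lips.
Proof.
move=> hh hg hp; rewrite ltnNge; apply/negP; rewrite leq_eqVlt => /orP[/eqP e|lt].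
  have ehg : g = h by rewrite -(nth_index h hg) e nth_index.
  by move: hp; rewrite ehg (negbTE (prec_irr h)).
have tot : total preceq.
  move=> f1 f2; rewrite /preceq [f2 == f1]eq_sym; case: (eqVneq f1 f2) => //= ne.
  exact: prec_total.
have := sorted_ltn_index preceq_trans (sort_sorted tot _) g h hg hh lt.
case/orP=> [/eqP e|hp2]; first by rewrite e ltnn in lt.
by have := prec_trans hp hp2; rewrite (negbTE (prec_irr h)).
Qed.

(** When [k] has the parity of [c], this is the least Lipschitz function with value at least [k] at
    [c]. *)
Definition cone (c : M) (k : nat) : fn :=
  [ffun x => inord (maxn (parity x) (k - dist c x))].

Lemma coneE c k x : k < D.*2.+2 -> cone c k x = maxn (parity x) (k - dist c x) :> nat.
Proof.
move=> hk; rewrite ffunE inordK // gtn_max (leq_trans (parity_lt2 x)) //=.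
exact: leq_ltn_trans (leq_subr _ _) hk.
Qed.

Lemma parity_dist x y : parity x <= parity y + dist x y.
Proof. by have := odd_dist x y; have := parity_lt2 x; have := parity_lt2 y; lia. Qed.

Lemma lipschitz_cone c k : k < D.*2.+2 -> odd k = odd (parity c) -> lipschitz (cone c k).
Proof.
move=> hk ok; apply/lipschitzP; split=> [x|x y].
  rewrite coneE // -odd_parity.
  rewrite /maxn; case: ltnP => // hlt.
  by rewrite oddB; [rewrite ok odd_dist oddD addKb|lia].
rewrite !coneE //; have := parity_dist x y; have := dist_triangle c x y.
lia.
Qed.

Definition eval (l : letter) (x : M) : nat :=
  match l with inl _ => parity x | inr i => nth parity_fun lips i x end.

Lemma lipschitz_nth i : lipschitz (nth parity_fun lips i).
Proof.
case: (ltnP i (size lips)) => hi.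
  by have := mem_nth parity_fun hi; rewrite mem_lips => /andP[].
rewrite nth_default //; apply/lipschitzP; split=> [x|x y]; rewrite !parity_funE ?odd_parity //.
exact: parity_dist.
Qed.

Lemma eval_odd l x : odd (eval l x) = odd (parity x).
Proof. by case: l => // i; apply: lipschitz_odd (lipschitz_nth i). Qed.

Lemma eval_dist l x y : eval l x <= eval l y + dist x y.
Proof. by case: l => [c|i]; [apply: parity_dist|apply: lipschitz_dist (lipschitz_nth i)]. Qed.

Lemma eval_lt l x : eval l x < D.*2.+2.
Proof. by case: l => [c|i] /=; [apply: leq_trans (parity_lt2 x) _|]. Qed.

Hypothesis distM : forall x y : M, dist x y <= D.

(** A cone at [x] of height [D.*2] or [D.*2.+1], whichever has the right parity, stays above the
    parity function within distance [D], so it drops by exactly [dist x y] at [y]. *)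
Lemma eval_far x y : x != y -> exists i, i < size lips /\ eval (Var i) x = eval (Var i) y + dist x y.
Proof.
move=> ne; pose k := parity x + D.*2.
have hk : k < D.*2.+2 by have := parity_lt2 x; rewrite /k; lia.
have ok : odd k = odd (parity x) by rewrite /k oddD odd_double addbF.
have d0 := dist_gt0 ne; have dD := distM x y; have p1 := parity_lt2 x; have p2 := parity_lt2 y.
have ex : cone x k x = k :> nat by rewrite coneE // distxx /k; lia.
have hc : cone x k \in lips.
  rewrite mem_lips lipschitz_cone //=; apply/eqP => e.
  by move: ex; rewrite e parity_funE /k; lia.
exists (index (cone x k) lips); rewrite index_mem hc /= nth_index //; split=> //.
rewrite ex coneE // /k; lia.
Qed.

(** A function larger at [x] than at [y] reaches [parity y + 2] at [x]. The cone of that height at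
    [y] separates the two points the other way and comes earlier in the list. *)
Lemma lips_first_difference i x y : i < size lips -> ole x y -> parity x = parity y ->
  (forall j, j < i -> eval (Var j) x = eval (Var j) y) ->
  eval (Var i) x <= eval (Var i) y.
Proof.
move=> hi hxy ep H; rewrite leqNgt; apply/negP => /= hlt.
set h := nth _ _ _ in hlt.
have hl : lipschitz h by apply: lipschitz_nth.
have ne : x != y by apply: contraTneq hlt => ->; rewrite ltnn.
have d1 := distM x y; have d0 := dist_gt0 ne.
have od := odd_dist x y; rewrite -ep in od.
have d2 : 1 < dist x y by lia.
pose k := (parity y).+2.
have hk : k < D.*2.+2 by have := parity_lt2 y; rewrite /k; lia.
pose h0 := cone y k.
have h0y : h0 y = k :> nat by rewrite coneE // distxx /k; lia.
have h0x : h0 x = parity x :> nat by rewrite coneE // dist_sym /k; lia.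
have h0l : lipschitz h0 by apply: lipschitz_cone => //=; rewrite negbK.
have h0lips : h0 \in lips.
  rewrite mem_lips h0l /=; apply/eqP => e.
  by move: h0y; rewrite e parity_funE /k; lia.
have hlips : h \in lips by apply: mem_nth.
have hx : k <= h x.
  by have := lipschitz_odd x hl; have := lipschitz_odd y hl; have := parity_le y hl; rewrite /k; lia.
have hne : h0 != h.
  by apply/eqP => e; rewrite -e h0x /k -ep in hx; lia.
have hp : prec h0 h.
  (* The cone attains its maximum [k] at [y] only, and at equal level [x] is more significant than
     [y]. *)
  case/orP: (prec_total hne) => // /existsP[c /top_atP[lc kc]].
  have [k1 _] : kle (h x) x (h0 c) c /\ kle (h0 x) x (h0 c) c.
    by apply: kc; apply/eqP => /(congr1 val) /= e; move: hx; rewrite e h0x /k -ep; lia.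
  have h0c : h0 c <= k.
    by rewrite coneE // /k; have := parity_lt2 c; lia.
  have ek : h0 c = k :> nat by have := kle_lt k1; lia.
  have ec : c = y.
    case: (eqVneq y c) => [->//|/dist_gt0 hd].
    by move: ek; rewrite coneE // /k; have := parity_lt2 c; lia.
  move: k1; rewrite /kle ek ltnNge hx /= => /andP[_ hcx].
  by case/eqP: ne; apply: ole_anti hxy _; rewrite -ec.
have := lips_index h0lips hlips hp; rewrite [X in _ < X]index_uniq ?uniq_lips //.
by move/H; rewrite /= nth_index // h0x h0y /k; lia.
Qed.

Definition code (h : fn) : letter :=
  if h == parity_fun then Cst 0 else Var (index h lips).

Lemma eval_code h x : lipschitz h -> eval (code h) x = h x.
Proof.
move=> hl; rewrite /code; case: eqP => [->|/eqP ne] /=; first by rewrite parity_funE.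
by rewrite nth_index // mem_lips hl.
Qed.

End Lipschitz.

(** * Restriction along an embedding *)

Lemma pword_intro t i m (v : seq letter) : i <= m ->
  (forall j, i <= j < m -> Var j \in v) ->
  (forall x, x < size v -> match nth (Cst 0) v x with
     | inl c => (c < t : Prop)
     | inr j => j < m /\ forall j', i <= j' < j -> Var j' \in take x v end) ->
  pword t i m v.
Proof.
elim: v i => [|l v IH] i him hin hx /=.
  by case: ltngtP him => // him _; have := hin i; rewrite leqnn him => /(_ isT).
have tail i' : i <= i' -> i' <= m -> (forall j, i' <= j -> (Var j == l) = false) ->
    pword t i' m v.
  move=> hi' hm hl; apply: IH => //.
    by move=> j /andP[h1 h2]; have := hin j; rewrite (leq_trans hi' h1) h2 inE hl // => /(_ isT).
  move=> x hxv; have := hx x.+1 hxv => /=.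
  case: (nth _ v x) => // j [h1 h2]; split=> // j' /andP[h3 h4].
  by have := h2 j'; rewrite (leq_trans hi' h3) h4 inE hl // => /(_ isT).
have := hx 0 isT => /=; case: l tail {hin hx} => [c|j] tail.
  by move=> ->; apply: tail.
case=> hj hj'; case: eqP => [e|ne].
  by subst j; apply: tail => // j hij; apply/eqP => -[]; lia.
have hji : j < i.
  by case: (ltnP j i) => // hij; have := hj' i; rewrite leqnn ltn_neqAle hij eq_sym andbT;
     move/eqP: ne => -> /(_ isT).
by rewrite hji; apply: tail => // j0 hij; apply/eqP => -[]; lia.
Qed.

Section Restriction.
Variables (D : nat) (A B : emspace) (f : A -> B).
Hypotheses (convA : convex_expansion A) (convB : convex_expansion B) (embf : embedding f).

Notation fnA := {ffun A -> 'I_D.*2.+2}.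
Notation fnB := {ffun B -> 'I_D.*2.+2}.
Implicit Types (g : fnA) (h : fnB).

Lemma parity_emb a : parity (f a) = parity a.
Proof. by case: embf => _ _ _ hp; rewrite /parity hp. Qed.

Lemma dist_emb a a' : dist (f a) (f a') = dist a a'.
Proof. by case: embf. Qed.

Lemma ole_emb a a' : ole (f a) (f a') = ole a a'.
Proof. by case: embf. Qed.

Definition restrict (h : fnB) : fnA := [ffun a => h (f a)].

Lemma lipschitz_restrict h : lipschitz h -> lipschitz (restrict h).
Proof.
case/lipschitzP=> h1 h2; apply/lipschitzP; split=> [a|a a']; rewrite !ffunE.
  by rewrite h1; case: embf => _ _ _ ->.
by rewrite -dist_emb.
Qed.

Lemma restrict_parity : restrict (parity_fun D B) = parity_fun D A.
Proof. by apply/ffunP => a; apply: val_inj; rewrite ffunE /= !parity_funE parity_emb. Qed.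

(* The pointwise least Lipschitz extension of [g]. *)
Definition extend (g : fnA) : fnB :=
  [ffun b => inord (maxn (parity b) (\max_a (g a - dist (f a) b)))].

Lemma extendE g b : extend g b = maxn (parity b) (\max_a (g a - dist (f a) b)) :> nat.
Proof.
rewrite ffunE inordK // gtn_max (leq_trans (parity_lt2 b)) //=.
rewrite ltnS; apply/bigmax_leqP => a _; have := ltn_ord (g a); lia.
Qed.

Lemma extendP g b : extend g b = parity b :> nat \/
  exists2 a, extend g b = g a - dist (f a) b :> nat & parity b < g a - dist (f a) b.
Proof.
rewrite extendE; case: (leqP (\max_a (g a - dist (f a) b)) (parity b)) => h.
  by left.
right; have cA : 0 < #|A|.
  by rewrite lt0n; apply: contraTneq h => /card0_eq A0; rewrite big_pred0.
have [a ea] := eq_bigmax (fun a => g a - dist (f a) b) cA.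
by exists a; rewrite -?ea.
Qed.

Lemma extend_ge g (a : A) b : g a <= extend g b + dist (f a) b.
Proof.
have : g a - dist (f a) b <= extend g b.
  by rewrite extendE leq_max (leq_bigmax (F := fun a => g a - dist (f a) b) a) ?orbT.
by rewrite leq_subLR addnC.
Qed.

Lemma extend_ge_parity g b : parity b <= extend g b.
Proof. by rewrite extendE leq_maxl. Qed.

Lemma lipschitz_extend g : lipschitz g -> lipschitz (extend g).
Proof.
move=> hg; apply/lipschitzP; split=> [b|b b'].
  rewrite -odd_parity; case: (extendP g b) => [->//|[a -> hlt]].
  rewrite oddB; last by lia.
  by rewrite (lipschitz_odd a hg) (odd_dist convB) oddD parity_emb addKb.
have := extend_ge_parity g b'; have := parity_dist convB b b'.
case: (extendP g b) => [->|[a -> hlt]]; first by lia.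
have := extend_ge g a b'; have := dist_triangle (f a) b b'; lia.
Qed.

Lemma extend_emb g a : lipschitz g -> extend g (f a) = g a :> nat.
Proof.
move=> hg; apply/eqP; rewrite eqn_leq; apply/andP; split.
  case: (extendP g (f a)) => [->|[a' -> _]]; first by rewrite parity_emb; apply: parity_le.
  by rewrite dist_emb; have := lipschitz_dist a' a hg; lia.
by have := extend_ge g a (f a); rewrite distxx addn0.
Qed.

Lemma restrict_extend g : lipschitz g -> restrict (extend g) = g.
Proof. by move=> hg; apply/ffunP => a; apply: val_inj; rewrite ffunE /= extend_emb. Qed.

(* A difference off the image of [f] is less significant than the difference on the
   image that causes it. *)
Lemma prec_extend g g' h : lipschitz g -> lipschitz g' -> lipschitz h ->
  restrict h = g -> prec g' g -> prec (extend g') h.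
Proof.
move=> hg hg' hh er /existsP[a2 /(top_atP convA)[l2 k2]].
have hE a : h (f a) = g a :> nat by rewrite -er ffunE.
have ne : extend g' != h.
  by apply/eqP => e; have := hE a2; rewrite -e extend_emb //; lia.
case/orP: (prec_total convB ne) => // /existsP[b /(top_atP convB)[lb kb]]; exfalso.
case: (extendP g' b) => [e|[a e hlt]].
  by have := parity_le b hh; lia.
(* The value at [b] comes from [a], where the functions also differ, at a level higher by
   [dist (f a) b]. As [b] is the top difference, [b = f a]; but then [a] and [a2] are both the top
   difference of [g'] and [g], with opposite signs. *)
have lip := lipschitz_dist (f a) b hh; rewrite hE in lip.
have la : g a < g' a by lia.
have nea : h (f a) != extend g' (f a).
  by apply/eqP => /(congr1 val) /=; rewrite hE extend_emb //; lia.
have [_ ka] := kb _ nea; rewrite extend_emb // in ka.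
have d0 : dist (f a) b = 0 by have := kle_lt ka; lia.
have eb : f a = b by apply/dist_eq0.
have nea' : g' a != g a by apply/eqP => /(congr1 val) /=; lia.
have [kg _] := k2 _ nea'.
have ne2 : h (f a2) != extend g' (f a2).
  by apply/eqP => /(congr1 val) /=; rewrite hE extend_emb //; lia.
have [kh _] := kb _ ne2; rewrite -eb hE extend_emb // in kh.
have kf : kle (g' a) (f a) (g a2) (f a2) by rewrite /kle ole_emb.
have [e1 e2] := kle_anti convB kf kh.
by case: embf => inj _ _ _; have ea := inj _ _ e2; subst a2; lia.
Qed.

Definition restriction_word : seq letter := [seq code (restrict h) | h <- lips D B].

(** Every variable occurs because [extend g] restricts to [g]. First occurrences are in order
    because, for [g'] before [g], [extend g'] comes before every function that restricts to [g]. *)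
Lemma param_word_restriction :
  param_word 1 (size (lips D A)) (size (lips D B)) restriction_word.
Proof.
rewrite /param_word size_map eqxx andbT.
have code_inv (h : fnA) j : code h = Var j -> lipschitz h ->
    j < size (lips D A) /\ h = nth (parity_fun D A) (lips D A) j.
  rewrite /code; case: eqP => // /eqP ne [<-] hl.
  have hin : h \in lips D A by rewrite mem_lips hl.
  by rewrite index_mem nth_index.
have codeV j : j < size (lips D A) -> exists g, [/\ g \in lips D A, code g = Var j,
    index g (lips D A) = j & extend g \in lips D B].
  move=> hj; pose g := nth (parity_fun D A) (lips D A) j.
  have gin : g \in lips D A by apply: mem_nth.
  have := gin; rewrite mem_lips => /andP[gl gne].
  have ig : index g (lips D A) = j by rewrite index_uniq // uniq_lips.
  exists g; split=> //; first by rewrite /code (negbTE gne) ig.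
  rewrite mem_lips lipschitz_extend //=; apply: contra gne => /eqP e.
  by rewrite -(restrict_extend gl) e restrict_parity.
apply: pword_intro => //.
  move=> j /= /codeV [g [gin cg _ ein]]; rewrite -cg.
  have := gin; rewrite mem_lips => /andP[gl _].
  by apply/mapP; exists (extend g); rewrite ?restrict_extend.
move=> x; rewrite size_map => hx.
rewrite (nth_map (parity_fun D B)) //.
set h := nth _ _ x; have hin : h \in lips D B by apply: mem_nth.
have := hin; rewrite mem_lips => /andP[hl _].
case e : (code (restrict h)) => [c|j].
  by move: e; rewrite /code; case: eqP => // _ [<-].
have [hj ej] := code_inv _ _ e (lipschitz_restrict hl); split=> // j' /= hj'.
have [g [gin cg ig ein]] := codeV _ (ltn_trans hj' hj).
have := gin; rewrite mem_lips => /andP[gl _].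
have rin : restrict h \in lips D A by rewrite ej; apply: mem_nth.
have ir : index (restrict h) (lips D A) = j by rewrite ej index_uniq // uniq_lips.
have pgr : prec g (restrict h).
  have ne : g != restrict h by apply: contraTneq hj' => eg; rewrite -ir -eg ig ltnn.
  case/orP: (prec_total convA ne) => // hp.
  by have := lips_index convA rin gin hp; rewrite ir ig ltnNge (ltnW hj').
have hp := prec_extend (lipschitz_restrict hl) gl hl erefl pgr.
have := lips_index convB ein hin hp; rewrite [X in _ < X]index_uniq ?uniq_lips // => lt.
rewrite -cg -(restrict_extend gl) -map_take; apply: map_f.
by rewrite -(nth_index (parity_fun D B) ein) -(nth_take _ lt); apply: mem_nth;
   rewrite size_takel // ltnW.
Qed.

Lemma eval_restriction l a :
  eval D (subst restriction_word l) a = eval D l (f a).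
Proof.
case: l => [c|i] /=; first by rewrite parity_emb.
case: (ltnP i (size (lips D B))) => hi; last first.
  by rewrite !nth_default ?size_map //= parity_funE parity_emb.
rewrite (nth_map (parity_fun D B)) // eval_code ?ffunE //.
by apply: lipschitz_restrict; apply: lipschitz_nth.
Qed.

End Restriction.

(** * The grid *)

Fixpoint lexle (s t : seq nat) :=
  match s, t with
  | [::], _ => true
  | _ :: _, [::] => false
  | x :: s', y :: t' => (x < y) || (x == y) && lexle s' t'
  end.

Lemma lexle_refl : reflexive lexle.
Proof. by elim=> //= x s ->; rewrite eqxx orbT. Qed.

Lemma lexle_anti : antisymmetric lexle.
Proof.
elim=> [|x s IH] [|y t] //= /andP[].
by case: ltngtP => //= -> h1 h2; rewrite (IH t) ?h1.
Qed.

Lemma lexle_trans : transitive lexle.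
Proof.
move=> t s; elim: s t => [|x s IH] [|y t] [|z u] //=.
case/orP=> [h1|/andP[/eqP-> h1]] /orP[h2|/andP[/eqP<- h2]].
- by rewrite (ltn_trans h1).
- by rewrite h1.
- by rewrite h2.
- by rewrite eqxx (IH t) ?orbT.
Qed.

Lemma lexle_total : total lexle.
Proof. by elim=> [|x s IH] [|y t] //=; case: ltngtP => //= _; apply: IH. Qed.

Section Grid.
Variables D n : nat.

(** The first coordinate is the bare parity: it records the predicate and, being compared first,
    makes the lexicographic order convex. *)
Definition on_grid (x : n.+1.-tuple 'I_D.*2.+2) :=
  (thead x < 2) && [forall i, odd (tnth x i) == odd (thead x)].

Definition grid := {x | on_grid x}.

Implicit Types x y z : grid.

Definition coord x (i : 'I_n.+1) : nat := tnth (val x) i.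
Definition coords x : seq nat := map val (val x).

Definition gdist x y := \max_i ((coord x i - coord y i) + (coord y i - coord x i)).

Lemma coord_inj x y : (forall i, coord x i = coord y i) -> x = y.
Proof. by move=> h; apply: val_inj; apply: eq_from_tnth => i; apply: val_inj; apply: h. Qed.

Lemma gdist_le x y k : reflect
  (forall i, coord x i <= coord y i + k /\ coord y i <= coord x i + k) (gdist x y <= k).
Proof.
apply: (iffP (bigmax_leqP _ _ _)) => h i; first by have := h i isT; lia.
by move=> _; have := h i; lia.
Qed.

Lemma gdist_ge x y i : coord x i <= coord y i + gdist x y.
Proof. by have /gdist_le/(_ i)[] := leqnn (gdist x y). Qed.

Lemma gdist_sym x y : gdist x y = gdist y x.
Proof. by apply: eq_bigr => i _; rewrite addnC. Qed.

Lemma gdist_eq0 x y : gdist x y = 0 <-> x = y.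
Proof.
split=> [h|->]; last by apply/eqP; rewrite -leqn0; apply/gdist_le => i; lia.
apply: coord_inj => i; have := gdist_ge x y i; have := gdist_ge y x i.
by rewrite gdist_sym h; lia.
Qed.

Lemma gdist_triangle x y z : gdist x z <= gdist x y + gdist y z.
Proof.
apply/gdist_le => i; have := gdist_ge x y i; have := gdist_ge y x i.
have := gdist_ge y z i; have := gdist_ge z y i.
rewrite (gdist_sym y x) (gdist_sym z y); lia.
Qed.

Definition grid_metric : mspace :=
  @MSpace {x | on_grid x} gdist gdist_eq0 gdist_sym gdist_triangle.

Definition grid_space : emspace := @EMSpace grid_metric
  (@Expansion grid_metric (fun x y => lexle (coords x) (coords y))
    [set x : {x | on_grid x} | ~~ odd (coord x ord0)]).

Lemma coord_odd x i : odd (coord x i) = odd (coord x ord0).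
Proof. by have /andP[_ /forallP/(_ i)/eqP] := valP x; rewrite /coord /thead. Qed.

Lemma coord0_lt2 x : coord x ord0 < 2.
Proof. by have /andP[] := valP x. Qed.

Lemma gdist_attained x y : exists i,
  gdist x y = (coord x i - coord y i) + (coord y i - coord x i).
Proof.
have c0 : 0 < #|'I_n.+1| by rewrite card_ord.
have [i ei] := eq_bigmax (fun i => (coord x i - coord y i) + (coord y i - coord x i)) c0.
by exists i; rewrite -ei.
Qed.

Lemma gdist_odd x y : odd (gdist x y) = odd (coord x ord0) (+) odd (coord y ord0).
Proof.
have [i ->] := gdist_attained x y; rewrite -(coord_odd x i) -(coord_odd y i).
case: (leqP (coord x i) (coord y i)) => h.
  by rewrite (eqP h) add0n oddB // addbC.
by rewrite (eqP (ltnW h)) addn0 oddB // ltnW.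
Qed.

Lemma coords_head x : exists s, coords x = coord x ord0 :: s.
Proof.
rewrite /coords /coord; case: (val x) => -[|h s] i //=.
by exists (map val s); rewrite (tnth_nth h).
Qed.

Lemma grid_convex : convex_expansion grid_space.
Proof.
have mem (x : grid_space) : (x \in bpart grid_space) = ~~ odd (coord x ord0) by rewrite inE.
have dE (x y : grid_space) : dist x y = gdist x y by [].
split.
- move=> x y z _ _ _; rewrite !dE !oddD !gdist_odd.
  by do 3!case: (odd (coord _ _)).
- move=> x y; rewrite !mem dE gdist_odd.
  by case: (odd (coord x _)); case: (odd (coord y _)); split=> //= h;
     solve [by left | by right | by case: h => -[]].
split.
  split.
  - by move=> x; apply: lexle_refl.
  - move=> x y /lexle_anti e; apply: val_inj; apply: val_inj.
    exact: (inj_map val_inj).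
  - by move=> x y z; apply: lexle_trans.
  - by move=> x y; apply: lexle_total.
move=> x y; rewrite !mem /ole /=.
have [s ->] := coords_head x; have [t ->] := coords_head y => /=.
have := coord0_lt2 x; have := coord0_lt2 y.
by case: (coord x ord0) => [|[|?]] //; case: (coord y ord0) => [|[|?]].
Qed.

Lemma mk_grid_subproof (F : 'I_n.+1 -> nat) :
  (forall i, F i < D.*2.+2) -> F ord0 < 2 -> (forall i, odd (F i) = odd (F ord0)) ->
  on_grid [tuple inord (F i) | i < n.+1].
Proof.
move=> hF h0 ho.
have E i : tnth [tuple inord (F i) : 'I_D.*2.+2 | i < n.+1] i = F i :> nat.
  by rewrite tnth_mktuple inordK.
by rewrite /on_grid /thead E h0; apply/forallP => i; rewrite !E ho.
Qed.

Lemma grid_point (F : 'I_n.+1 -> nat) :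
  (forall i, F i < D.*2.+2) -> F ord0 < 2 -> (forall i, odd (F i) = odd (F ord0)) ->
  {x : grid | forall i, coord x i = F i}.
Proof.
move=> hF h0 ho; exists (Sub _ (mk_grid_subproof hF h0 ho)) => i.
by rewrite /coord SubK tnth_mktuple inordK.
Qed.

Lemma coordsE x (s : seq nat) : size s = n.+1 ->
  (forall i, coord x i = nth 0 s i) -> coords x = s.
Proof.
move=> ss h; apply: (@eq_from_nth _ 0); rewrite size_map size_tuple ?ss // => i hi.
rewrite (nth_map ord0) ?size_tuple // -(h (Ordinal hi)) /coord (tnth_nth ord0) //.
Qed.

Section Embed.
Variable M : emspace.
Hypothesis convM : convex_expansion M.

(** The prepended constant letter supplies the parity coordinate. *)
Definition grid_vector w (a : M) (i : 'I_n.+1) := eval D (nth (Cst 0) (Cst 0 :: w) i) a.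

Definition grid_map (w : seq letter) (a : M) : grid_space := sval (@grid_point (grid_vector w a)
  (fun i => eval_lt D _ a) (parity_lt2 a)
  (fun i => eval_odd D convM (nth (Cst 0) (Cst 0 :: w) i) a)).

Lemma coord_grid_map w a i : coord (grid_map w a) i = grid_vector w a i.
Proof. by rewrite /grid_map; case: grid_point. Qed.

Lemma coords_grid_map w a : size w = n ->
  coords (grid_map w a) = parity a :: map (fun l => eval D l a) w.
Proof.
move=> sw; apply: coordsE => [|i]; first by rewrite /= size_map sw.
rewrite coord_grid_map /grid_vector.
by rewrite -[parity a :: _]/(map (fun l => eval D l a) (Cst 0 :: w)) (nth_map (Cst 0)) //= sw.
Qed.

Hypothesis distM : forall x y : M, dist x y <= D.

(** As long as no difference has shown, all variables seen so far agree at [a] and [b]. The next new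
    variable is then a possible first difference in the list of Lipschitz functions, which goes the
    right way. *)
Lemma lexle_eval w i m (a b : M) : m = size (lips D M) -> pword 1 i m w ->
  ole a b -> parity a = parity b ->
  (forall j, j < i -> eval D (Var j) a = eval D (Var j) b) ->
  lexle (map (fun l => eval D l a) w) (map (fun l => eval D l b) w).
Proof.
move=> em; elim: w i => [|[c|x] w IH] i //=.
  case/andP=> _ hw hab ep H; rewrite ep eqxx (IH i) ?orbT //.
case: eqP => [-> hw|_ /andP[hx hw]] hab ep H; last first.
  by have /= -> := H _ hx; rewrite eqxx (IH i) ?orbT.
have hi : i < size (lips D M) by rewrite -em; apply: pword_le hw.
have := lips_first_difference convM distM hi hab ep H.
rewrite /= leq_eqVlt => /orP[/eqP e|->//].
rewrite e eqxx (IH i.+1) ?orbT // => j; rewrite ltnS leq_eqVlt => /orP[/eqP->//|]; exact: H.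
Qed.

Lemma pword_mem t i m w j : pword t i m w -> i <= j < m -> Var j \in w.
Proof.
elim: w i => [|[c|x] w IH] i /=.
- by move/eqP->; lia.
- by case/andP=> _ /IH h /h; rewrite inE => ->; rewrite orbT.
- case: eqP => [-> /IH h hj|_ /andP[_ /IH h] /h]; last by rewrite inE => ->; rewrite orbT.
  rewrite inE; case: eqP => //= ne; apply: h.
  by case/andP: hj; rewrite leq_eqVlt => /orP[/eqP e|->//]; case: ne; rewrite e.
Qed.

(** Distances do not grow because all letters are Lipschitz, and do not shrink because every
    variable occurs, among them the cones of [eval_far]. *)
Lemma grid_map_embedding w : param_word 1 (size (lips D M)) n w ->
  embedding (grid_map w).
Proof.
case/andP=> hw /eqP sw.
have iso a b : dist (grid_map w a) (grid_map w b) = dist a b.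
  change (gdist (grid_map w a) (grid_map w b) = dist a b).
  apply/eqP; rewrite eqn_leq; apply/andP; split.
    apply/gdist_le => i; rewrite !coord_grid_map; split; first exact: eval_dist.
    by rewrite dist_sym; apply: eval_dist.
  case: (eqVneq a b) => [->|ne]; first by rewrite distxx.
  have [i [hi ei]] := eval_far convM distM ne.
  have iw : Var i \in w by apply: pword_mem hw _.
  have hlt : (index (Var i) w).+1 < n.+1 by rewrite ltnS -sw index_mem.
  have := gdist_ge (grid_map w a) (grid_map w b) (Ordinal hlt).
  by rewrite !coord_grid_map /grid_vector /= nth_index // -/(eval D (Var i) a) -/(eval D (Var i) b) ei; lia.
have inj : injective (grid_map w).
  by move=> a b e; apply/dist_eq0; rewrite -iso e distxx.
have par a : (grid_map w a \in bpart grid_space) = (a \in bpart M).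
  by rewrite inE coord_grid_map /= /grid_vector /= odd_parity negbK.
have mono a b : ole a b -> ole (grid_map w a) (grid_map w b).
  move=> hab; rewrite /ole /= !coords_grid_map //=.
  case: (ltngtP (parity a) (parity b)) => // ep.
    have [_ _ [_ /(_ a b)]] := convM.
    by move: ep; rewrite /parity; case: (a \in _); case: (b \in _) => //= _ /(_ isT hab).
  exact: lexle_eval hw hab ep _.
split=> // a b; apply/idP/idP; last exact: mono.
move=> h; case/orP: (ole_total convM a b) => // /mono h'.
by rewrite (inj a b) ?ole_refl //; apply: ole_anti h h'; apply: grid_convex.
Qed.

End Embed.

(** Composition of words is composition of maps: the copies of [A] inside the copy of [B] given by
    [w] arise by substituting restriction words. *)
Lemma grid_map_restriction (A B : emspace) (convA : convex_expansion A)
    (convB : convex_expansion B) (f : A -> B) w a : embedding f ->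
  grid_map convA (wcomp w (restriction_word D f)) a = grid_map convB w (f a).
Proof.
move=> embf; apply: coord_inj => i; rewrite !coord_grid_map /grid_vector.
rewrite -(eval_restriction D convB embf); congr (eval D _ a).
case: (val i) => [|j] //=.
case: (ltnP j (size w)) => hj; first by rewrite (nth_map (Cst 0)).
by rewrite !nth_default ?size_map.
Qed.

End Grid.

(** * The Ramsey property *)

Definition max_dist (M : mspace) := \max_(p : M * M) dist p.1 p.2.

Lemma dist_le_max (M : mspace) (x y : M) : dist x y <= max_dist M.
Proof. exact: (leq_bigmax (F := fun p : M * M => dist p.1 p.2) (x, y)). Qed.

Lemma embedding_comp (A B C : emspace) (g : B -> C) (f : A -> B) :
  embedding g -> embedding f -> embedding (g \o f).
Proof.
case=> i1 d1 o1 p1 [i2 d2 o2 p2]; split=> [|x y|x y|x] /=.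
- exact: inj_comp.
- by rewrite d1.
- by rewrite o1.
- by rewrite p1.
Qed.

Lemma ramsey_embeddings (A B : emspace) (K : finType) :
  convex_expansion A -> convex_expansion B ->
  exists C, convex_expansion C /\ forall chi : {set C} -> K,
    exists (g : B -> C) (c : K), embedding g /\
      forall f : A -> B, embedding f -> chi ((g \o f) @: [set: A]) = c.
Proof.
move=> convA convB; pose D := max_dist B.
have [n Hn] := @graham_rothschild 1 (size (lips D A)) isT (size (lips D B)) K.
exists (grid_space D n); split; first exact: grid_convex.
move=> chi; have [w [c [hw hc]]] := Hn (fun z => chi (grid_map D n convA z @: [set: A])).
exists (grid_map D n convB w), c; split.
  by apply: grid_map_embedding => // x y; apply: dist_le_max.
move=> f embf; rewrite -(hc (restriction_word D f)); last exact: param_word_restriction.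
by congr chi; apply: eq_imset => a /=; rewrite (grid_map_restriction _ _ convA convB).
Qed.

Lemma ramsey_convex : ramsey convex_expansion.
Proof.
move=> A B convA convB k k0.
have [C [convC HC]] := @ramsey_embeddings A B 'I_k convA convB.
exists C; split=> // chi; have [g [c [embg hc]]] := HC chi.
exists (g @: [set: B]); split; first by exists g.
exists c => A' [h [embh ->]] sub.
(* A copy of [A] inside the image of [g] factors through [g]. *)
have /fin_all_exists [f hf] : forall a, exists b, h a = g b.
  by move=> a; have /imsetP[b _ ->] := subsetP sub _ (imset_f h (in_setT a)); exists b.
have embf : embedding f.
  case: embh embg => [ih dh oh ph] [ig dg og pg]; split.
  - by move=> a b e; apply: ih; rewrite !hf e.
  - by move=> a b; rewrite -dg -!hf dh.
  - by move=> a b; rewrite -og -!hf oh.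
  - by move=> a; rewrite -pg -hf ph.
by rewrite -(hc f embf); congr chi; apply: eq_imset => a; apply: hf.
Qed.

(** * The expansion property *)

Lemma size_lips D (M : emspace) : size (lips D M) <= #|{ffun M -> 'I_D.*2.+2}|.
Proof. by rewrite size_sort -cardE max_card. Qed.

Lemma embeds_grid D n (M : emspace) : convex_expansion M ->
  (forall x y : M, dist x y <= D) -> #|{ffun M -> 'I_D.*2.+2}| <= n ->
  embeds M (grid_space D n).
Proof.
move=> convM distM hn; set m := size (lips D M).
have hm : m <= n := leq_trans (size_lips D M) hn.
(* Each Lipschitz function in the list is used once; the remaining coordinates repeat the parity. *)
exists (grid_map D n convM ([seq Var i | i <- iota 0 m] ++ nseq (n - m) (Cst 0))).
apply: grid_map_embedding => //; apply/andP; split.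
  by apply: pword_cat_known; [rewrite all_nseq orbT|apply: (pword_iota 1 0 m)].
by rewrite size_cat size_map size_iota size_nseq subnKC.
Qed.

(** Iterates the Ramsey property over finitely many structures: the new one is handled in the outer
    space, the earlier ones by colourings pulled back along [g']. *)
Lemma ramsey_family (X : nat -> emspace) (B : emspace) N :
  (forall i, convex_expansion (X i)) -> convex_expansion B ->
  exists C, convex_expansion C /\ forall chi : nat -> {set C} -> bool,
    exists g : B -> C, embedding g /\ forall i, i < N -> exists c,
      forall f : X i -> B, embedding f -> chi i ((g \o f) @: [set: X i]) = c.
Proof.
move=> convX convB; elim: N => [|N [C [convC HC]]].
  by exists B; split=> // chi; exists id; split=> //; split.
have [C' [convC' HC']] := @ramsey_embeddings (X N) C bool (convX N) convC.
exists C'; split=> // chi; have [g' [c [embg' hc]]] := HC' (chi N).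
have [g [embg hg]] := HC (fun i S => chi i (g' @: S)).
exists (g' \o g); split; first exact: embedding_comp.
move=> i; rewrite ltnS leq_eqVlt => /orP[/eqP->|/hg [d hd]].
  by exists c => f embf; rewrite -(hc (g \o f)) //; apply: embedding_comp.
by exists d => f embf; rewrite -(hd f embf) -imset_comp.
Qed.

(** * Monochromatic pairs and grid triangles *)

Section Pair.
Variables (k : nat) (s : bool).

Definition pair_dist (x y : bool) := if x == y then 0 else k.+1.*2.

Lemma pair_dist_eq0 x y : pair_dist x y = 0 <-> x = y.
Proof. by case: x; case: y. Qed.

Lemma pair_dist_sym x y : pair_dist x y = pair_dist y x.
Proof. by case: x; case: y. Qed.

Lemma pair_dist_triangle x y z : pair_dist x z <= pair_dist x y + pair_dist y z.
Proof. by case: x; case: y; case: z => //=; rewrite /pair_dist /=; lia. Qed.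

Definition pair_metric : mspace := MSpace pair_dist_eq0 pair_dist_sym pair_dist_triangle.

Definition pair_space : emspace :=
  @EMSpace pair_metric (@Expansion pair_metric implb [set x : bool | s]).

Lemma pair_convex : convex_expansion pair_space.
Proof.
have odd0 (x y : pair_space) : odd (dist x y) = false.
  by rewrite /= /pair_dist; case: eqP => //= _; rewrite odd_double.
split.
- by move=> x y z _ _ _; rewrite !oddD !odd0.
- move=> x y; rewrite odd0 !inE; split=> // _.
  by case: s; [left|right].
split; last by move=> x y; rewrite !inE.
by split; [case|case=> -[]|case=> -[] []|case=> -[]].
Qed.

Lemma pair_embedding (M : emspace) (x y : M) : convex_expansion M ->
  ole x y -> x != y -> (x \in bpart M) = s -> (y \in bpart M) = s ->
  dist x y = k.+1.*2 -> embedding (fun b : pair_space => if b then y else x).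
Proof.
move=> convM hxy ne hx hy hd.
have yx : ole y x = false.
  by apply: contraNF ne => h; apply/eqP; apply: ole_anti hxy h.
split.
- by case=> -[] // e; case/eqP: ne.
- by case=> -[]; rewrite ?distxx //= dist_sym.
- by case=> -[]; rewrite /ole /= -/(ole _ _) ?ole_refl.
- by case; rewrite inE.
Qed.

End Pair.

Lemma grid_point3 D n (s : bool) q r : odd q = s -> odd r = s ->
  q < D.*2.+2 -> r < D.*2.+2 ->
  {x : grid D n.+2 | coords x = [:: nat_of_bool s, q, r & nseq n (nat_of_bool s)] &
    forall i, coord x i = if i == 1 :> nat then q else if i == 2 :> nat then r else s}.
Proof.
move=> oq or hq hr.
have [||i|x hx] := @grid_point D n.+2
    (fun i => if i == 1 :> nat then q else if i == 2 :> nat then r else s).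
- by move=> i; case: ifP => // _; case: ifP => // _; case: s {oq or}.
- by case: s {oq or}.
- by rewrite /= oddb; case: ifP => // _; case: ifP => // _; rewrite oddb.
exists x => //; apply: coordsE => [|i]; first by rewrite /= size_nseq.
rewrite hx; case: i => -[|[|[|i]]] //= hi.
by rewrite nth_nseq ifT //; lia.
Qed.

(** Here [s] is the parity, true off the predicate. In coordinates 1 and 2 the points are [(s, s)],
    [(s, s + d)] and [(s + 2, s)]; all other coordinates equal [s]. *)
Lemma grid_triangle D n (s : bool) d : 0 < d -> d <= D -> ~~ odd d ->
  exists x y z : grid_space D n.+2,
    [/\ (x \in bpart (grid_space D n.+2)) = ~~ s,
        (y \in bpart (grid_space D n.+2)) = ~~ s &
        (z \in bpart (grid_space D n.+2)) = ~~ s] /\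
    [/\ ole x y, ole y z, dist x y = d, dist y z = d & dist x z = 2].
Proof.
move=> d0 dD ed.
have d2 : 1 < d by case: d d0 ed {dD} => [|[|d]].
have s1 : s <= 1 by case: s.
have [b1 b2 b3] : [/\ s + d < D.*2.+2, s + 2 < D.*2.+2 & s < D.*2.+2] by split; lia.
have os : odd s = s := oddb s.
have od : odd (s + d) = s by rewrite oddD (negbTE ed) addbF.
have o2 : odd (s + 2) = s by rewrite oddD addbF.
have [x cx ex] := grid_point3 n os os b3 b3.
have [y cy ey] := grid_point3 n os od b3 b1.
have [z cz ez] := grid_point3 n o2 os b2 b3.
have i1 : 1 < n.+3 by []; have i2 : 2 < n.+3 by [].
have E1 := (ex (Ordinal i1), ey (Ordinal i1), ez (Ordinal i1)).
have E2 := (ex (Ordinal i2), ey (Ordinal i2), ez (Ordinal i2)).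
have le u v m : (forall i, coord u i <= coord v i + m) ->
    (forall i, coord v i <= coord u i + m) -> @gdist D n.+2 u v <= m.
  by move=> h1 h2; apply/gdist_le.
exists x, y, z; split; split; rewrite ?inE ?ex ?ey ?ez ?os //.
- by rewrite /ole /= cx cy /= !ltnn !eqxx /= ltn_neqAle leq_addr; apply/orP; left; apply/eqP; lia.
- by rewrite /ole /= cy cz /= !ltnn !eqxx /=; apply/orP; left; lia.
- apply/eqP; rewrite eqn_leq; apply/andP; split.
    by apply: le => i; rewrite ex ey; do !case: ifP => _; lia.
  by have := gdist_ge y x (Ordinal i2); rewrite gdist_sym !E2 /=; lia.
- apply/eqP; rewrite eqn_leq; apply/andP; split.
    by apply: le => i; rewrite ey ez; do !case: ifP => _; lia.
  by have := gdist_ge y z (Ordinal i2); rewrite !E2 /=; lia.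
- apply/eqP; rewrite eqn_leq; apply/andP; split.
    by apply: le => i; rewrite ex ez; do !case: ifP => _; lia.
  by have := gdist_ge z x (Ordinal i1); rewrite gdist_sym !E1 /=; lia.
Qed.

(** * Twists of an expansion and the expansion property *)

Section Twist.
Variables (A : mspace) (a : expansion A) (flip : bool) (sign : bool -> bool).
Hypothesis conva : convex_expansion (EMSpace a).

Let Q : {set A} := [set x | (x \in upred a) (+) flip].

Definition twist : expansion A := Expansion
  (fun x y => if (x \in Q) == (y \in Q)
              then if sign (x \in Q) then ord a x y else ord a y x
              else x \in Q) Q.

Lemma twist_convex : convex_expansion (EMSpace twist).
Proof.
have [odd_free det [[r an tr tot] cv]] := conva.
rewrite /ole /= in r an tr tot.
split=> //.
  move=> u v; have := det u v; rewrite /bpart /= !inE.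
  by case: flip; case: (u \in _); case: (v \in _) => /=; tauto.
split; last first.
  by move=> u v; rewrite /bpart /ole /=; case: eqP => [-> //|_ _].
split; rewrite /ole /=.
- by move=> x; rewrite eqxx; case: sign.
- move=> x y; rewrite [(y \in Q) == _]eq_sym; case: eqP => [->|].
    by case: sign => h; apply: an; rewrite // andbC.
  by case: (x \in Q); case: (y \in Q).
- move=> y x z; case: (x \in Q); case: (y \in Q); case: (z \in Q) => //=.
    by case: sign => h1 h2; [apply: tr h1 h2|apply: tr h2 h1].
  by case: sign => h1 h2; [apply: tr h1 h2|apply: tr h2 h1].
- move=> x y; rewrite [(y \in Q) == _]eq_sym; case: eqP => [->|].
    by case: sign.
  by case: (x \in Q); case: (y \in Q).
Qed.

End Twist.

(** The metric determines the predicate once its value at one point is known. *)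
Lemma bpart_flip (M : mspace) (a b : expansion M) : convex_expansion (EMSpace a) ->
  convex_expansion (EMSpace b) -> exists flip, forall x : M,
    (x \in upred a) = (x \in upred b) (+) flip.
Proof.
move=> conva convb; case: (pickP (@predT M)) => [x0 _|M0]; last first.
  by exists false => x; have := M0 x.
exists ((x0 \in upred a) (+) (x0 \in upred b)) => x.
have := odd_dist convb x0 x; rewrite [odd _](odd_dist conva x0 x) !oddD !odd_parity /bpart /=.
by case: (x0 \in upred a); case: (x0 \in upred b);
   case: (x \in upred a); case: (x \in upred b).
Qed.

(** Any convex order [b] on [C] is, on a suitable grid, the grid order or its reverse on each side
    of the bipartition, as far as distances up to [D] are concerned. *)
Lemma grid_signs D n : exists C, convex_expansion C /\
  forall b : expansion C, convex_expansion (EMSpace b) ->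
  exists (g : grid_space D n.+2 -> C) (sign : bool -> bool), embedding g /\
    forall x y, (x \in bpart (grid_space D n.+2)) = (y \in bpart (grid_space D n.+2)) ->
      dist x y <= D -> ole x y -> x != y ->
      ord b (g x) (g y) = sign (x \in bpart (grid_space D n.+2)).
Proof.
set G := grid_space D n.+2; have convG : convex_expansion G := grid_convex D n.+2.
(* The index [s + k.*2] encodes the pair at distance [k.+1.*2] on side [s]. *)
have [C [convC HC]] := @ramsey_family (fun i => pair_space i./2 (odd i)) G D.+1.*2
  (fun i => pair_convex _ _) convG.
exists C; split=> // b convb.
have olb x : ord b x x by have := ole_refl convb x.
(* A pair is coloured by whether [b] agrees with the given order on it. *)
have [g [embg hg]] := HC (fun _ S =>
  [forall u in S, forall v in S, ole u v ==> ord b u v]).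
have [ig _ og _] := embg.
have col k s : k <= D -> exists c, forall x y : G, ole x y -> x != y ->
    (x \in bpart G) = s -> (y \in bpart G) = s -> dist x y = k.+1.*2 ->
    ord b (g x) (g y) = c.
  move=> kD; have hi : s + k.*2 < D.+1.*2 by case: s; lia.
  have := hg _ hi; rewrite half_bit_double oddD odd_double oddb addbF => -[c hc].
  exists c => x y hxy ne hx hy hd.
  rewrite -(hc _ (pair_embedding convG hxy ne hx hy hd)); apply/idP/forall_inP.
    move=> h _ /imsetP[[] _ ->]; apply/forall_inP => _ /imsetP[[] _ ->] /=; apply/implyP => //.
    rewrite og => hyx; case/eqP: ne; exact: ole_anti hxy hyx.
  move=> h.
  have /forall_inP h2 := h (g x) (imset_f (g \o _) (in_setT (false : pair_space k s))).
  have /implyP := h2 (g y) (imset_f (g \o _) (in_setT (true : pair_space k s))).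
  by rewrite og; apply.
(* The sign of a side is read off at distance 2. *)
have /fin_all_exists [sign hsign] := fun s => col 0 s (leq0n D).
exists g, sign; split=> // x y epar hD hxy ne.
have d0 := dist_gt0 ne.
have ed : ~~ odd (dist x y).
  have [_ det _] := convG; apply/det; rewrite -epar.
  by case: (x \in _); [left|right].
have [k hk] : exists k, dist x y = k.+1.*2.
  by exists (dist x y)./2.-1; have := odd_double_half (dist x y); rewrite (negbTE ed); lia.
have kD : k <= D by lia.
have [c hc] := col k (x \in bpart G) kD.
rewrite (hc x y) //.
(* If [b] keeps, or reverses, both pairs at distance [d], then by transitivity it does the same to
   the pair at distance 2. *)
have [u [v [w [[pu pv pw] [uv vw duv dvw duw]]]]] := grid_triangle n (x \notin bpart G) d0 hD ed.
rewrite negbK in pu pv pw.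
have neq p q e : dist p q = e -> 0 < e -> p != q :> G.
  by move=> <-; apply: contraTneq => ->; rewrite distxx.
have nuv := neq _ _ _ duv d0; have nvw := neq _ _ _ dvw d0; have nuw := neq _ _ _ duw isT.
have uw := ole_trans convG uv vw.
have cuv : ord b (g u) (g v) = c by apply: hc; rewrite ?duv.
have cvw : ord b (g v) (g w) = c by apply: hc; rewrite ?dvw.
rewrite -(hsign _ u w) //.
have trb p q r : ord b p q -> ord b q r -> ord b p r by apply: (ole_trans convb).
case: c {hc} cuv cvw => cuv cvw; first by rewrite (trb _ _ _ cuv cvw).
have := ole_total convb (g u) (g v); rewrite /ole /= cuv /= => vu.
have := ole_total convb (g v) (g w); rewrite /ole /= cvw /= => wv.
apply/esym/negbTE; apply: contra nuw => h; apply/eqP/ig.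
exact: (ole_anti convb) h (trb _ _ _ wv vu).
Qed.

Lemma ole_neq (M : emspace) (x y : M) : convex_expansion M -> x != y ->
  ole y x = ~~ ole x y.
Proof.
move=> convM ne; apply/idP/idP => [hyx|h].
  by apply: contra ne => hxy; apply/eqP; apply: ole_anti hxy hyx.
by have := ole_total convM x y; rewrite (negbTE h).
Qed.

Lemma ole_cross (M : emspace) (x y : M) : convex_expansion M ->
  (x \in bpart M) != (y \in bpart M) -> ole x y = (x \in bpart M).
Proof.
move=> convM; have [_ _ [_ cv]] := convM.
case hx: (x \in _); case hy: (y \in _) => // _.
  have := ole_total convM x y; case: (ole x y) => //= /(cv _ _ hx).
  by rewrite hy.
by apply: contraFF hx; apply: cv.
Qed.

Lemma expansion_property_convex : expansion_property no_odd_triangle convex_expansion.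
Proof.
move=> A _; pose D := max_dist A; pose n := #|{ffun A -> 'I_D.*2.+2}|.
have [C [convC HC]] := grid_signs D n.
exists (reduct C); split; first by case: convC.
move=> a b conva convb; have [g [sign [embg hg]]] := HC b convb.
set G := grid_space D n.+2 in g sign embg hg.
have convC' : convex_expansion (EMSpace (exp_of C)) by case: C convC {HC a b g sign embg hg conva convb}.
have [flip hflip] := bpart_flip convb convC'.
(* [b] changes the grid by [flip] and [sign]; doing the same to [a] beforehand makes the two changes
   cancel. *)
have convt := twist_convex flip sign conva.
have [f embf] : embeds (EMSpace (twist a flip sign)) G.
  apply: embeds_grid => //; first by move=> x y; apply: dist_le_max.
  by rewrite /= -/n ltnW // ltnW.
exists (g \o f).
case: embg => ig dg og pg; case: embf => jf df of_ pf.
have part x : (g (f x) \in upred b) = (x \in upred a).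
  rewrite hflip -[upred (exp_of C)]/(bpart C) pg pf inE.
  by rewrite addbK.
split=> /=.
- exact: inj_comp.
- by move=> x y; rewrite -[LHS]/(@dist C _ _) dg df.
- move=> x y; case: (eqVneq x y) => [->|ne]; first by rewrite !ole_refl.
  case: (eqVneq (x \in upred a) (y \in upred a)) => [epar|npar]; last first.
    by rewrite !ole_cross // /bpart /= ?part.
  have eQ : (f x \in bpart G) = (f y \in bpart G) by rewrite !pf !inE epar.
  have ne' : g (f x) != g (f y) by rewrite !(inj_eq ig) (inj_eq jf).
  have ole_t p q : (f p \in bpart G) = (f q \in bpart G) -> ole (f p) (f q) =
      if sign (f p \in bpart G) then ord a p q else ord a q p.
    by move=> e; rewrite of_ /ole /=; rewrite !pf in e *; rewrite e eqxx.
  have na := ole_neq conva ne; have nb := ole_neq convb ne'.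
  rewrite /ole /= in na nb *.
  (* The grid also has distances above [D], for which the signs say nothing. *)
  have dD : dist (f x) (f y) <= D by rewrite df; apply: dist_le_max.
  have nef : f x != f y by rewrite (inj_eq jf).
  case/orP: (ole_total (grid_convex D n.+2) (f x) (f y)) => hxy.
    rewrite (hg _ _ eQ dD hxy nef); move: hxy; rewrite ole_t // na.
    by case: (sign _) => //; case: (ord a x y).
  rewrite dist_sym in dD; rewrite eq_sym in nef.
  have := hg _ _ (esym eQ) dD hxy nef; move: hxy; rewrite ole_t // na nb.
  by case: (sign _) => //; case: (ord a x y); case: (ord b _ _).
- exact: part.
Qed.

Theorem theorem8p1 :
  ramsey convex_expansion /\
  expansion_property no_odd_triangle convex_expansion.
Proof. by split; [exact: ramsey_convex|exact: expansion_property_convex]. Qed.
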